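(* Let $\mathcal{A}_1,\mathcal{A}_2,\dots$ be a computable sequence of alphabets with $|\mathcal{A}_i|=2$ for every $i$. Then there exists a computable infinite cube-free word $w=w_1w_2w_3\cdots$ with $w_i\in\mathcal{A}_i$ for every $i$. Moreover, there is an algorithm that, given $w_1\cdots w_n$ and $\mathcal{A}_{n+1}$, computes $w_{n+1}$ in time polynomial in $n$.
   Context: An alphabet is a finite set (here, without loss of generality, a finite subset of $\mathbb{N}$). A cube is a word of the form $uuu$ with $u$ a nonempty word. A (finite or infinite) word is cube-free if none of its factors (contiguous subwords) is a cube. *)

(* Defs.v *)
From mathcomp Require Import all_boot.
From mathcomp Require Import finmap.

Set Implicit Arguments.
Unset Strict Implicit.
Unset Printing Implicit Defensive.

Definition is_cube (s : seq nat) : Prop :=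
  exists2 u : seq nat, u <> [::] & s = u ++ u ++ u.

Definition factor_of (s : seq nat) (w : nat -> nat) : Prop :=
  exists i n : nat, s = mkseq (fun j => w (i + j)) n.

Definition cube_free (w : nat -> nat) : Prop :=
  forall s : seq nat, factor_of s w -> ~ is_cube s.

(* The model of computation is a random access machine a la Cook and Reckhow,
   with registers X_0, X_1, ... holding natural numbers: constants, addition,
   truncated subtraction, indirect addressing and a conditional jump, each
   executed in one step.  Without multiplication, this uniform cost measure is
   polynomially equivalent to Turing machine time.  A letter occupies one
   register, so that a time bound can depend on the length of a word only, and
   not on the size of the numbers that serve as letters. *)
Inductive instr : Type :=
  | Const of nat & nat
  | Add of nat & nat & nat
  | Sub of nat & nat & nat
  | Fetch of nat & nat
  | Store of nat & nat
  | Jpos of nat & nat.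

Definition program : Type := seq instr.

Record config : Type := Config { pc : nat; mem : nat -> nat }.

Definition upd (m : nat -> nat) (d v : nat) : nat -> nat :=
  fun j => if j == d then v else m j.

Definition exec (i : instr) (x : config) : config :=
  let m := mem x in
  let next m' := Config (pc x).+1 m' in
  match i with
  | Const d c => next (upd m d c)
  | Add d a b => next (upd m d (m a + m b))
  | Sub d a b => next (upd m d (m a - m b))
  | Fetch d a => next (upd m d (m (m a)))
  | Store a b => next (upd m (m a) (m b))
  | Jpos a l => if 0 < m a then Config l m else next m
  end.

(* The machine halts when the program counter leaves the program; a halted
   configuration is a fixed point of [step]. *)
Definition halted (P : program) (x : config) : bool := size P <= pc x.

Definition step (P : program) (x : config) : config :=
  if onth P (pc x) is Some i then exec i x else x.

(* A list is stored as its length in X_0 followed by its items in X_1, X_2,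
   ...; all other registers are initially 0. *)
Definition init (s : seq nat) : config := Config 0 (nth 0 (size s :: s)).

Definition output (x : config) : seq nat :=
  mkseq (fun i => mem x i.+1) (mem x 0).

(* Since halted configurations are stationary, this says that P, started on the
   input list s, halts after at most t steps with the output list r. *)
Definition outputs_within (P : program) (t : nat) (s r : seq nat) : Prop :=
  let x := iter t (step P) (init s) in halted P x /\ output x = r.

Definition computable_seq (f : nat -> seq nat) : Prop :=
  exists P : program, forall i : nat,
    exists t : nat, outputs_within P t [:: i] (f i).

(* A finite alphabet is presented to, or produced by, a machine as the
   increasing list of its letters. *)
Definition letters (B : {fset nat}) : seq nat := sort leq (enum_fset B).

Definition computable_alphabets (A : nat -> {fset nat}) : Prop :=
  computable_seq (fun i => letters (A i)).

Definition computable_word (w : nat -> nat) : Prop :=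
  computable_seq (fun i => [:: w i]).

Definition encode (u : seq nat) (B : {fset nat}) : seq nat :=
  size u :: u ++ letters B.

(* Main.v *)
From Stdlib Require Import Reals Lra ZArith.
Require Import Defs.
From mathcomp Require Import all_boot.
From mathcomp Require Import finmap.
From mathcomp Require Import zify_ssreflect.
Import Defs.

Set Implicit Arguments.
Unset Strict Implicit.
Unset Printing Implicit Defensive.

(* For a period p let r_p be the number of consecutive positions at the end of
   a word at which it agrees with its shift by p; a cube of period p ends the
   word iff r_p >= 2p. A new letter increases r_p by 1 if it equals the p-th
   letter from the end, and resets r_p to 0 otherwise. The letter is chosen
   greedily: it minimises the potential
   sum_p k_p (3/4)^(2p) ((4/3)^(r_p) - 1), with k_1 = 11, k_2 = 8 and k_p = 6
   for p > 2.

   For two distinct letters x and y, no period contributes to both potentials,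
   so that over the periods p > 4 they add up to at most 4/3 times the old
   potential plus a constant. This is too weak for the small periods, but there
   the numbers r_1, ..., r_4, together with the equalities between the last four
   letters, form a finite automaton, and an exhaustive check of its 92 reachable
   states shows that a potential below 6 (1 - (3/4)^10) can be kept below this
   threshold, which excludes cubes. The potential of a word of length n is
   computed with O(n^2) additions, after multiplication by a power of 4.

   The word is computable because the machine for the alphabets can be simulated
   in a shifted part of the memory, which is cleared after each run. *)

Delimit Scope R_scope with Re.

(** * The potential *)

(* Words are lists with the most recent letter first. *)
Fixpoint run (p : nat) (u : seq nat) : nat :=
  if u is x :: v then
    if onth v p.-1 == Some x then (run p v).+1 else 0
  else 0.

Definition coef (p : nat) : nat := 6 + (3 - p).*2 + (2 - p).

(** * The finite automaton of the periods up to 4 *)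

Definition same_vote (u : seq nat) (ij : nat * nat) : bool :=
  (onth u ij.1 == onth u ij.2) && (onth u ij.1 != None).

Definition state : Type := (seq nat * seq bool)%type.

Definition state_of (u : seq nat) : state :=
  ([seq run p u | p <- iota 1 4],
   [seq same_vote u ij | ij <- [:: (0,1); (0,2); (0,3); (1,2); (1,3); (2,3)]]).

Definition bits (u : seq nat) (x : nat) : seq bool :=
  [seq onth u i == Some x | i <- iota 0 4].

(** Transitivity of equality: of the facts that the new letter equals the letter at one place, that
    it equals the letter at another place, and that these two places agree, any two imply the third.
    Admitting every bit vector with this property over-approximates the letters that can follow. *)
Definition consistent (s : state) (b : seq bool) : bool :=
  match s.2, b with
  | [:: e01; e02; e03; e12; e13; e23], [:: b0; b1; b2; b3] =>
    let ok e a c := [&& a && c ==> e, a && e ==> c & c && e ==> a] in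
    [&& ok e01 b0 b1, ok e02 b0 b2, ok e03 b0 b3,
        ok e12 b1 b2, ok e13 b1 b3 & ok e23 b2 b3]
  | _, _ => false
  end.

Definition new_runs (s : state) (b : seq bool) : seq nat :=
  [seq if rb.2 then rb.1.+1 else 0 | rb <- zip s.1 b].

(** A new letter shifts the places by one: its comparisons with the last three letters become the
    pairs (0, j), and the old pairs (i, j) become (i+1, j+1). *)
Definition next_state (s : state) (b : seq bool) : state :=
  (new_runs s b,
   match s.2, b with
   | [:: e01; e02; e03; e12; e13; e23], [:: b0; b1; b2; b3] =>
     [:: b0; b1; b2; e01; e02; e12]
   | _, _ => [::]
   end).

Definition cubic (r : seq nat) : bool :=
  has (fun pr => pr.1.*2 <= pr.2) (zip (iota 1 4) r).

Definition all_bits : seq (seq bool) :=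
  let two := [seq [:: a; b] | a <- [:: false; true], b <- [:: false; true]] in
  [seq a ++ b | a <- two, b <- two].

(* Integer weights and bounds for the exhaustive check are scaled by 4^10. *)
Definition weightZ (p r : nat) : Z :=
  (Z.of_nat (coef p) * (3 ^ Z.of_nat (p.*2 - r) * 4 ^ Z.of_nat (10 - p.*2 + r)
   - 3 ^ Z.of_nat (p.*2) * 4 ^ Z.of_nat (10 - p.*2)))%Z.

Definition smallZ (r : seq nat) : Z :=
  foldr (fun pr a => (weightZ pr.1 pr.2 + a)%Z) 0%Z (zip (iota 1 4) r).

Definition thresholdZ : Z := 5937162%Z.
(* An upper bound for 4^10 (32/7) (3/4)^10, which is what the periods p > 4
   with r_p = 0 contribute. *)
Definition DZ : Z := 269939%Z.

(* If one letter completes a cube, the other one has to stay below the threshold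
   alone; otherwise it suffices that the average of both does. *)
Definition pair_ok (s : state) (b c : seq bool) : bool :=
  let F := smallZ s.1 in
  let Fb := smallZ (new_runs s b) in
  let Fc := smallZ (new_runs s c) in
  if cubic (new_runs s b) then
    ~~ cubic (new_runs s c) && (4 * (thresholdZ - F) + 3 * DZ + 3 * Fc <=? 3 * thresholdZ)%Z
  else if cubic (new_runs s c) then
    (4 * (thresholdZ - F) + 3 * DZ + 3 * Fb <=? 3 * thresholdZ)%Z
  else (4 * (thresholdZ - F) + 3 * DZ + 3 * Fb + 3 * Fc <=? 6 * thresholdZ)%Z.

Definition disjoint_bits (b c : seq bool) : bool :=
  ~~ has (fun bc => bc.1 && bc.2) (zip b c).

Definition succs (s : state) : seq state :=
  if (thresholdZ <=? smallZ s.1)%Z then [::] else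
  [seq next_state s b | b <- all_bits & consistent s b && ~~ cubic (new_runs s b)].

(** Nothing is proved about this search. That its result is closed under letters that complete no
    short cube is part of the check [state_ok], so exhausted fuel could only make that check
    fail. *)
Fixpoint explore (fuel : nat) (todo seen : seq state) : seq state :=
  if fuel is k.+1 then
    if todo is s :: todo' then
      let new := [seq t <- undup (succs s) | t \notin seen] in
      explore k (new ++ todo') (new ++ seen)
    else seen
  else seen.

Definition reach : seq state := explore 1000 [:: state_of [::]] [:: state_of [::]].

(** The first alternative covers states in which the short periods alone reach the threshold;
    [good_not_full] rules them out. The remaining condition combines closure of [reach] with the
    estimate for every pair of distinct letters. *)
Definition state_ok (s : state) : bool :=
  (thresholdZ <=? smallZ s.1)%Z ||
  all (fun b => consistent s b ==>
    (cubic (new_runs s b) || (next_state s b \in reach)) &&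
    all (fun c => consistent s c && disjoint_bits b c ==> pair_ok s b c) all_bits)
  all_bits.

Lemma state_ok_reach : all state_ok reach.
Proof. by vm_cast_no_check (erefl true). Qed.

Lemma st0_reach : state_of [::] \in reach.
Proof. by vm_compute. Qed.

(** A period up to 4 compares the new letter with one of the last four letters, so the new state
    depends on [x] only through its bits. *)
Lemma st_cons x u : state_of (x :: u) = next_state (state_of u) (bits u x).
Proof.
rewrite /state_of /next_state /new_runs /bits /same_vote /=.
by congr ([:: _; _; _; _], [:: _; _; _; _; _; _]);
  rewrite ?(eq_sym (Some x)) /= ?andbT.
Qed.

Lemma run4_cons x u :
  [seq run p (x :: u) | p <- iota 1 4] = new_runs (state_of u) (bits u x).
Proof. by have [] := st_cons x u. Qed.

Lemma consistent_bits u x : consistent (state_of u) (bits u x).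
Proof.
have ok (a c : option nat) : let e := (a == c) && (a != None) in
    let sx t := t == Some x in
    [&& sx a && sx c ==> e, sx a && e ==> sx c & sx c && e ==> sx a].
  case: a c => [a|] [c|] //=; rewrite ?andbT ?andbF //=.
  have oE (y z : nat) : (Some y == Some z) = (y == z) by [].
  by rewrite !oE; case: (a =P x); case: (c =P x); case: (a =P c) => //; congruence.
by rewrite /consistent /state_of /bits /same_vote; do 5?[apply/andP; split; first exact: ok]; exact: ok.
Qed.

Lemma all_bitsP u x : bits u x \in all_bits.
Proof. by rewrite /bits /=; do 4?case: (_ == Some x). Qed.

Lemma disjoint_bitsP u x y : x != y -> disjoint_bits (bits u x) (bits u y).
Proof.
move=> nxy; have h i : (onth u i == Some x) && (onth u i == Some y) = false.
  by apply/andP => -[/eqP-> /eqP[exy]]; rewrite exy eqxx in nxy.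
by move: (h 0) (h 1) (h 2) (h 3); rewrite /disjoint_bits /= => -> -> -> ->.
Qed.

Lemma run_oversize p u : 0 < p -> size u <= p -> run p u = 0.
Proof.
case: p => // p _; case: u => //= x u le_up; rewrite onth_default //.
Qed.

(** * Real weights and the effect of one letter on them *)

Definition wt (p r : nat) : R :=
  (INR (coef p) * (3 / 4) ^ p.*2 * ((4 / 3) ^ r - 1))%Re.

Lemma weightZ_wt p r :
  0 < p <= 4 -> r <= p.*2 -> IZR (weightZ p r) = (4 ^ 10 * wt p r)%Re.
Proof.
case: p => [|[|[|[|[|p]]]]] //= _;
  by do 9?[case: r => [|r]] => //= _; rewrite /weightZ /wt /=; cbv -[IZR Rmult Rplus Rminus Rdiv Rinv pow INR]; rewrite /=; field.
Qed.

Definition small (u : seq nat) : R :=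
  (wt 1 (run 1 u) + (wt 2 (run 2 u) + (wt 3 (run 3 u) + wt 4 (run 4 u))))%Re.

Fixpoint tail (k : nat) (u : seq nat) : R :=
  if k is j.+1 then (tail j u + wt (5 + j) (run (5 + j) u))%Re else 0%Re.

Lemma tailS k u : tail k.+1 u = (tail k u + wt (5 + k) (run (5 + k) u))%Re.
Proof. by []. Qed.

Definition pot (u : seq nat) : R := (small u + tail (size u) u)%Re.

(** The weight of period 5 when it completes a cube, that is with run 10; longer periods completing
    a cube weigh at least as much ([wt_big]). *)
Definition threshold : R := (6 * (1 - (3 / 4) ^ 10))%Re.

(** Only cubes at the end of the word are excluded; a cube elsewhere ends a shorter prefix. *)
Definition no_cube (u : seq nat) : Prop := forall p, 0 < p -> run p u < p.*2.

Lemma coef_big p : 2 < p -> coef p = 6.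
Proof. rewrite /coef; lia. Qed.

Lemma pow34_gt0 n : (0 < (3 / 4) ^ n)%Re.
Proof. apply: pow_lt; lra. Qed.

Lemma pow34_le a b : a <= b -> ((3 / 4) ^ b <= (3 / 4) ^ a)%Re.
Proof.
move=> le_ab; have -> : b = a + (b - a) by lia.
rewrite pow_add -[X in (_ <= X)%Re]Rmult_1_r; apply: Rmult_le_compat_l.
  by have := pow34_gt0 a; lra.
rewrite -(pow1 (b - a)); apply: pow_incr; lra.
Qed.

Lemma pow43_ge1 n : (1 <= (4 / 3) ^ n)%Re.
Proof. apply: pow_R1_Rle; lra. Qed.

Lemma wt_ge0 p r : (0 <= wt p r)%Re.
Proof.
apply: Rmult_le_pos; last by have := pow43_ge1 r; lra.
by apply: Rmult_le_pos; [exact: pos_INR | have := pow34_gt0 p.*2; lra].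
Qed.

Lemma wt0 p : wt p 0 = 0%Re.
Proof. by rewrite /wt /=; ring. Qed.

(** At most one of the two letters continues the run, and the other one gets weight 0. Continuing
    multiplies the weight by 4/3 and adds [coef p / 3 = 2] times [(3/4)^(2p)]. *)
Lemma wt_step p u (x y : nat) : 2 < p -> x != y ->
  (wt p (run p (x :: u)) + wt p (run p (y :: u))
   <= 4 / 3 * wt p (run p u) + 2 * (3 / 4) ^ p.*2)%Re.
Proof.
move=> p_gt2 nxy.
have c0 := pow34_gt0 p.*2; have w0 := wt_ge0 p (run p u).
have up : wt p (run p u).+1 = (4 / 3 * wt p (run p u) + 2 * (3 / 4) ^ p.*2)%Re.
  rewrite /wt coef_big //=; set a := ((4 / 3) ^ _)%Re; set b := ((3 / 4) ^ _)%Re.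
  by simpl; field.
rewrite /=; case: eqP => [->|_]; case: eqP => [exy|_].
- by case: exy nxy => ->; rewrite eqxx.
- rewrite wt0 up; lra.
- rewrite wt0 up; lra.
- rewrite !wt0; lra.
Qed.

Lemma tail_step k u (x y : nat) : x != y ->
  (tail k (x :: u) + tail k (y :: u)
   < 4 / 3 * tail k u + 32 / 7 * (3 / 4) ^ 10)%Re.
Proof.
move=> nxy.
(* The added constants form a geometric series of ratio 9/16 with total [32/7 (3/4)^10]; keeping the
   exact partial sum makes the induction work and yields the strict inequality. *)
suff: (tail k (x :: u) + tail k (y :: u) <= 4 / 3 * tail k u
       + 32 / 7 * ((3 / 4) ^ 10 - (3 / 4) ^ (5 + k).*2))%Re.
  have := pow34_gt0 (5 + k).*2; lra.
elim: k => [|k IH]; first by rewrite /=; lra.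
have := @wt_step (5 + k) u x y isT nxy.
rewrite !tailS addnS doubleS; move: IH; set q := 5 + k.
rewrite -(tech_pow_Rmult _ (_.*2).+1) -(tech_pow_Rmult _ (_.*2)).
move: (wt q _) (wt q _) (wt q _) => a b c; lra.
Qed.

Lemma tail_mono j k u : j <= k -> (tail j u <= tail k u)%Re.
Proof.
elim: k => [|k IH]; first by rewrite leqn0 => /eqP->; right.
rewrite leq_eqVlt => /orP[/eqP->|]; first by right.
move=> /IH; rewrite tailS; have := wt_ge0 (5 + k) (run (5 + k) u); lra.
Qed.

Lemma tail_oversize k u : (tail k u <= tail (size u) u)%Re.
Proof.
case: (leqP k (size u)) => [|]; first exact: tail_mono.
elim: k => // k IH; rewrite ltnS tailS => le_k.
rewrite (@run_oversize (5 + k)) ?wt0; [|lia|lia].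
by move: le_k; rewrite leq_eqVlt => /orP[/eqP <-|/IH]; lra.
Qed.

Lemma tail_wt k p u : 4 < p < 5 + k -> (wt p (run p u) <= tail k u)%Re.
Proof.
move=> hp; have -> : p = 5 + (p - 5) by lia.
have: (tail (p - 5).+1 u <= tail k u)%Re by apply: tail_mono; lia.
have: (0 <= tail (p - 5) u)%Re by apply: (@tail_mono 0).
rewrite tailS; lra.
Qed.

Lemma small_ge0 u : (0 <= small u)%Re.
Proof.
rewrite /small; move: (wt_ge0 1 (run 1 u)) (wt_ge0 2 (run 2 u))
  (wt_ge0 3 (run 3 u)) (wt_ge0 4 (run 4 u)); lra.
Qed.

Lemma tail_ge0 k u : (0 <= tail k u)%Re.
Proof. exact: (@tail_mono 0). Qed.

Lemma smallZ_small u : (forall p, 0 < p <= 4 -> run p u <= p.*2) ->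
  IZR (smallZ [seq run p u | p <- iota 1 4]) = (4 ^ 10 * small u)%Re.
Proof.
move=> h; rewrite /smallZ [zip _ _]/= [foldr _ _ _]/= !plus_IZR.
rewrite !weightZ_wt ?h // /small; lra.
Qed.

Lemma cubicP u :
  cubic [seq run p u | p <- iota 1 4] = false ->
  forall p, 0 < p <= 4 -> run p u < p.*2.
Proof.
rewrite /cubic /= !orbF => /norP[h1 /norP[h2 /norP[h3 h4]]].
by case=> [|[|[|[|[|p]]]]] // _; rewrite ltnNge.
Qed.

Lemma wt_big p r : 4 < p -> p.*2 <= r -> (threshold <= wt p r)%Re.
Proof.
move=> p4 le_r; rewrite /wt coef_big; last by lia.
have -> : INR 6 = 6%Re by rewrite /=; lra.
have e : ((3 / 4) ^ p.*2 * (4 / 3) ^ p.*2 = 1)%Re.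
  rewrite -Rpow_mult_distr; have -> : (3 / 4 * (4 / 3) = 1)%Re by field.
  exact: pow1.
have l1 : ((4 / 3) ^ p.*2 <= (4 / 3) ^ r)%Re by apply: Rle_pow; [lra|lia].
have l2 : ((3 / 4) ^ p.*2 <= (3 / 4) ^ 10)%Re by apply: pow34_le; lia.
have c0 := pow34_gt0 p.*2.
rewrite /threshold; nra.
Qed.

Lemma pot_no_cube u : (pot u < threshold)%Re ->
  cubic [seq run p u | p <- iota 1 4] = false -> no_cube u.
Proof.
move=> lt_th nc p p_gt0; case: (leqP p 4) => p4; first by apply: cubicP => //; lia.
rewrite ltnNge; apply/negP => ge_r.
have lt_p : p < size u.
  by rewrite ltnNge; apply/negP => le_p; move: ge_r; rewrite run_oversize //; lia.
have := @tail_wt (size u) p u; have := wt_big p4 ge_r.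
have := small_ge0 u; move: lt_th; rewrite /pot => H1 H2 H3 H4.
have {H4} := H4 _; have h : 4 < p < 5 + size u by lia.
move/(_ h); lra.
Qed.

(* Locked, as [done] would otherwise evaluate the whole exploration. *)
Definition reachable (s : state) : bool := locked (s \in reach).

Lemma reachableE s : reachable s = (s \in reach).
Proof. by rewrite /reachable -lock. Qed.

(** * The invariant and its extension by one of two letters *)

Definition good (u : seq nat) : Prop :=
  [/\ no_cube u, reachable (state_of u) & (pot u < threshold)%Re].

Lemma good_nil : good [::].
Proof.
split; [by move=> [|p] | by rewrite reachableE; exact: st0_reach|].
by rewrite /pot /small /= !wt0 /threshold /=; lra.
Qed.

Lemma good_smallZ u : good u ->
  IZR (smallZ (state_of u).1) = (4 ^ 10 * small u)%Re.
Proof.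
by case=> nc _ _; apply: smallZ_small => p /andP[p0 _]; exact/ltnW/nc.
Qed.

Lemma IZR_thresholdZ : IZR thresholdZ = (4 ^ 10 * threshold)%Re.
Proof. by rewrite /thresholdZ /threshold /=; lra. Qed.

Lemma good_not_full u : good u -> (thresholdZ <=? smallZ (state_of u).1)%Z = false.
Proof.
move=> gu; apply/Z.leb_gt; apply: lt_IZR; rewrite IZR_thresholdZ good_smallZ //.
by case: gu; have := tail_ge0 (size u) u; rewrite /pot; lra.
Qed.

Lemma good_state_ok u (x : nat) : good u ->
  cubic (new_runs (state_of u) (bits u x)) || reachable (state_of (x :: u)) /\
  (forall y, x != y -> pair_ok (state_of u) (bits u x) (bits u y)).
Proof.
move=> gu; have ltF := good_not_full gu.
case: gu => _ inr _; rewrite reachableE in inr.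
have := allP state_ok_reach _ inr; move: inr => _.
rewrite /state_ok ltF orFb => /allP/(_ _ (all_bitsP u x)).
rewrite consistent_bits -st_cons -reachableE implyTb => /andP[-> /allP ok].
split=> // y nxy; move: (ok _ (all_bitsP u y)).
by rewrite consistent_bits disjoint_bitsP // implyTb.
Qed.

Lemma reachable_cons u (x : nat) :
  good u -> no_cube (x :: u) -> reachable (state_of (x :: u)).
Proof.
move=> /(good_state_ok x)[+ _] nc; case: (boolP (cubic _)) => //=.
rewrite -run4_cons.
have -> : [seq run p (x :: u) | p <- iota 1 4] =
  [:: run 1 (x :: u); run 2 (x :: u); run 3 (x :: u); run 4 (x :: u)] by [].
move: (nc 1 isT) (nc 2 isT) (nc 3 isT) (nc 4 isT).
move: (run _ _) (run _ _) (run _ _) (run _ _) => a b c d.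
by rewrite /cubic /= !ltnNge => /negbTE-> /negbTE-> /negbTE-> /negbTE->.
Qed.

(** The tail of [u] is below [threshold - small u], and by [tail_step] the two new tails together
    stay below 4/3 of it plus a constant. Adding the new small parts gives the inequalities of
    [pair_ok], there scaled by [4^10] and cleared of denominators. *)
Lemma good_cons u (x y : nat) : good u -> x != y -> good (x :: u) \/ good (y :: u).
Proof.
move=> gu nxy; have [rx /(_ y nxy)] := good_state_ok x gu.
have [ry _] := good_state_ok y gu.
have E0 := good_smallZ gu; have thE := IZR_thresholdZ; case: gu => nc _ lt_th.
(* From a run below [2p], one letter leads to at most [2p], the range in which [weightZ] is
   exact. *)
have rle z p : 0 < p <= 4 -> run p (z :: u) <= p.*2.
  by case/andP=> p0 _; rewrite [run _ _]/=; case: ifP => // _; apply: (nc p p0).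
have Ex := smallZ_small (rle x); have Ey := smallZ_small (rle y).
rewrite !run4_cons in Ex Ey.
have DE : (4 ^ 10 * (32 / 7 * (3 / 4) ^ 10) <= IZR DZ)%Re by rewrite /DZ /=; lra.
have step := tail_step (size u).+1 u nxy.
have le_t := tail_oversize (size u).+1 u.
have mk z : (pot (z :: u) < threshold)%Re -> cubic (new_runs (state_of u) (bits u z)) = false ->
    cubic (new_runs (state_of u) (bits u z)) || reachable (state_of (z :: u)) ->
    good (z :: u).
  by move=> lt c; rewrite c /=; split=> //; apply: pot_no_cube; rewrite ?run4_cons.
have tx := tail_ge0 (size u).+1 (x :: u); have ty := tail_ge0 (size u).+1 (y :: u).
have T : (4 ^ 10 = 1048576)%Re by rewrite /=; lra.
rewrite !T in thE DE E0 Ex Ey.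
move: DE step; set d := (32 / 7 * _)%Re => DE step.
rewrite /pair_ok; move: (smallZ _) (smallZ _) (smallZ _) E0 Ex Ey => F Fx Fy E0 Ex Ey.
(* If [x] completes a short cube, its tail is dropped as nonnegative, and [y] alone carries the
   whole estimate. *)
case: ifPn => [cx /andP[/negbTE cy /Z.leb_le/IZR_le]|/negbTE cx].
  rewrite !(plus_IZR, minus_IZR, mult_IZR) E0 Ey thE => H.
  right; apply: mk => //; move: lt_th; rewrite /pot [size (_ :: _)]/=; lra.
case: ifPn => [cy /Z.leb_le/IZR_le|/negbTE cy /Z.leb_le/IZR_le];
  rewrite !(plus_IZR, minus_IZR, mult_IZR) E0 Ex ?Ey thE => H.
  left; apply: mk => //; move: lt_th; rewrite /pot [size (_ :: _)]/=; lra.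
(* The two potentials sum to less than twice the threshold, so one of them is below it. *)
have [lx|gx] := Rlt_le_dec (pot (x :: u)) threshold; [left|right]; apply: mk => //.
move: lt_th gx; rewrite /pot ![size (_ :: _)]/=; lra.
Qed.

(** * Integer scores for comparing potentials *)

(* For a cube, [e = 0]: the extra summand [1 - e] then lifts the score above the
   threshold also for p < 5. *)
Definition term (N : nat) (u : seq nat) (p : nat) : nat :=
  let e := p.*2 - run p u in (coef p + (1 - e)) * (3 ^ e * 4 ^ (N - e)).

Fixpoint score (N k : nat) (u : seq nat) : nat :=
  if k is j.+1 then score N j u + term N u k else 0.

(** The periods up to [size u + 4] are those of [pot u] ([wsum_pot]), and the exponent
    [2 (size u + 4)] makes all terms integral. Without a cube at the end, the score is the scaled
    potential plus [base], which depends on the length only. *)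
Definition total_score (u : seq nat) : nat :=
  score (size u + 4).*2 (size u + 4) u.

Definition choice (u : seq nat) (x y : nat) : nat :=
  if total_score (y :: u) < total_score (x :: u) then y else x.

Fixpoint base (k : nat) : R :=
  if k is j.+1 then (base j + INR (coef k) * (3 / 4) ^ k.*2)%Re else 0%Re.

Fixpoint wsum (k : nat) (u : seq nat) : R :=
  if k is j.+1 then (wsum j u + wt k (run k u))%Re else 0%Re.

Lemma scoreS N k u : score N k.+1 u = score N k u + term N u k.+1.
Proof. by []. Qed.

Lemma baseS k : base k.+1 = (base k + INR (coef k.+1) * (3 / 4) ^ k.+1.*2)%Re.
Proof. by []. Qed.

Lemma wsumS k u : wsum k.+1 u = (wsum k u + wt k.+1 (run k.+1 u))%Re.
Proof. by []. Qed.

Lemma wsum_pot u : wsum (size u + 4) u = pot u.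
Proof.
rewrite /pot; elim: (size u) => [|k IH]; first by rewrite /small /=; ring.
by rewrite addSn wsumS IH tailS -addnS addnC; ring.
Qed.

Lemma INR_pow a n : INR (a ^ n) = (INR a ^ n)%Re.
Proof. by elim: n => [|n IH] //; rewrite expnS mult_INR IH. Qed.

Lemma INR_term N u p : p.*2 <= N ->
  let e := p.*2 - run p u in
  INR (term N u p) = (4 ^ N * (INR (coef p + (1 - e)) * (3 / 4) ^ e))%Re.
Proof.
move=> le_N e; have le_e : e <= N by rewrite /e; lia.
rewrite /term -/e !mult_INR !INR_pow.
have -> : INR 3 = 3%Re by rewrite /=; ring.
have -> : INR 4 = 4%Re by rewrite /=; ring.
have e4 : (4 ^ N = 4 ^ e * 4 ^ (N - e))%Re by rewrite -pow_add; congr (_ ^ _)%Re; lia.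
have -> : (3 ^ e = (3 / 4) ^ e * 4 ^ e)%Re.
  by rewrite -Rpow_mult_distr; congr (_ ^ _)%Re; field.
rewrite e4; ring.
Qed.

Lemma wt_eq p r : r <= p.*2 ->
  (INR (coef p) * (3 / 4) ^ (p.*2 - r)
   = INR (coef p) * (3 / 4) ^ p.*2 + wt p r)%Re.
Proof.
move=> le_r; have E2 : p.*2 = (p.*2 - r) + r by lia.
rewrite /wt {2 3}E2 pow_add.
have e : ((3 / 4) ^ r * (4 / 3) ^ r = 1)%Re.
  rewrite -Rpow_mult_distr; have -> : (3 / 4 * (4 / 3) = 1)%Re by field.
  exact: pow1.
by rewrite Rmult_minus_distr_l Rmult_1_r !Rmult_assoc e; ring.
Qed.

Lemma INR_score_no_cube N k u : no_cube u -> k.*2 <= N ->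
  INR (score N k u) = (4 ^ N * (base k + wsum k u))%Re.
Proof.
move=> nc; elim: k => [|k IH] le_N; first by rewrite /=; ring.
have lt_r := nc k.+1 isT.
rewrite scoreS (plus_INR (score _ _ _)) IH ?INR_term //; last by lia.
have -> : 1 - (k.+1.*2 - run k.+1 u) = 0 by lia.
by rewrite addn0 wt_eq ?(ltnW lt_r) // baseS wsumS; ring.
Qed.

Lemma INR_term_ge N u p : p.*2 <= N ->
  (4 ^ N * (INR (coef p) * (3 / 4) ^ p.*2) <= INR (term N u p))%Re.
Proof.
move=> le_N; rewrite INR_term //; apply: Rmult_le_compat_l.
  by apply: pow_le; lra.
set e := p.*2 - _; apply: Rmult_le_compat; first exact: pos_INR.
- have := pow34_gt0 p.*2; lra.
- by apply: le_INR; lia.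
by apply: pow34_le; rewrite /e; lia.
Qed.

Lemma INR_term_cube N u p : 0 < p -> p.*2 <= N -> p.*2 <= run p u ->
  (4 ^ N * (INR (coef p) * (3 / 4) ^ p.*2 + threshold) <= INR (term N u p))%Re.
Proof.
move=> p0 le_N le_r; rewrite INR_term //; apply: Rmult_le_compat_l.
  by apply: pow_le; lra.
have -> : p.*2 - run p u = 0 by lia.
case: p p0 {le_N le_r} => [|[|[|p]]] // _; rewrite /threshold.
- by rewrite /coef /=; lra.
- by rewrite /coef /=; lra.
(* As [6 (3/4)^6 + threshold < 7], one estimate serves all periods above 2. *)
have le6 : ((3 / 4) ^ p.+3.*2 <= (3 / 4) ^ 6)%Re by apply: pow34_le; lia.
by rewrite coef_big //; move: le6; move: ((3 / 4) ^ p.+3.*2)%Re => a; rewrite /=; lra.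
Qed.

Lemma INR_score_ge N k u : k.*2 <= N ->
  (4 ^ N * base k <= INR (score N k u))%Re.
Proof.
elim: k => [|k IH] le_N; first by rewrite /=; lra.
have := @INR_term_ge N u k.+1 le_N; have {}IH := IH (leq_trans _ le_N).
rewrite scoreS (plus_INR (score _ _ _)) baseS Rmult_plus_distr_l.
have : k.*2 <= k.+1.*2 by lia.
by move/IH; lra.
Qed.

(** The period of the cube contributes the excess; every other period contributes at least its share
    of [base], whatever its run. *)
Lemma INR_score_cube N k p u : 0 < p <= k -> p.*2 <= run p u -> k.*2 <= N ->
  (4 ^ N * (base k + threshold) <= INR (score N k u))%Re.
Proof.
move=> hp le_r; elim: k hp => [|k IH] hp le_N; first by lia.
rewrite scoreS (plus_INR (score _ _ _)) baseS.
have le_N' : k.*2 <= N by lia.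
move: hp; rewrite [p <= _]leq_eqVlt => /andP[p0 /orP[/eqP ep|lt_p]].
  rewrite -ep in le_N *; have := INR_term_cube p0 le_N le_r.
  have := @INR_score_ge N k u le_N'; lra.
have := @INR_term_ge N u k.+1 le_N.
by have := IH _ le_N'; rewrite p0 /= => /(_ lt_p); lra.
Qed.

Lemma total_no_cube u : no_cube u ->
  INR (total_score u) =
  (4 ^ (size u + 4).*2 * (base (size u + 4) + pot u))%Re.
Proof. by move=> nc; rewrite /total_score INR_score_no_cube // wsum_pot. Qed.

(** For an extension of a good word, being good is equivalent to a score below
    [C * (B + threshold)]. One of the letters achieves this by [good_cons], hence so does the letter
    of lower score, without any search for cubes. *)
Lemma good_choice u (x y : nat) : good u -> x != y -> good (choice u x y :: u).
Proof.
move=> gu nxy; set B := base ((size u).+1 + 4).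
set C := (4 ^ ((size u).+1 + 4).*2)%Re.
have C0 : (0 < C)%Re by apply: pow_lt; lra.
have lt_good z : good (z :: u) -> (INR (total_score (z :: u)) < C * (B + threshold))%Re.
  case=> nc _ lt_th; rewrite total_no_cube //; apply: Rmult_lt_compat_l => //.
  rewrite [size (_ :: _)]/= -/B; lra.
have good_lt z : (INR (total_score (z :: u)) < C * (B + threshold))%Re -> good (z :: u).
  move=> lt; have nc : no_cube (z :: u).
    move=> p p0; rewrite ltnNge; apply/negP => ge_r.
    have lt_p : p < size (z :: u).
      by rewrite ltnNge; apply/negP => le_p; move: ge_r; rewrite run_oversize //; lia.
    have hp : 0 < p <= (size u).+1 + 4 by move: lt_p => /=; lia.
    have := INR_score_cube hp ge_r (leqnn _); move: lt.
    by rewrite /total_score [size (_ :: _)]/= -/C -/B; lra.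
  split=> //; first exact: reachable_cons.
  move: lt; rewrite total_no_cube // => /(Rmult_lt_reg_l _ _ _ C0).
  by rewrite [size (_ :: _)]/= -/B; lra.
have le_choice z : z = x \/ z = y ->
    total_score (choice u x y :: u) <= total_score (z :: u).
  by rewrite /choice; case: ltnP => ? [->|->] //; lia.
have [z ez gz] : exists2 z, z = x \/ z = y & good (z :: u).
  by case: (good_cons gu nxy); [exists x; [left|] | exists y; [right|]].
apply: good_lt; apply: (Rle_lt_trans _ _ _ _ (lt_good z gz)).
by apply: le_INR; have := le_choice z ez; lia.
Qed.

(** * The greedy word and its cube-freeness *)

Fixpoint pref (L : nat -> seq nat) (n : nat) : seq nat :=
  if n is k.+1 then
    choice (pref L k) (nth 0 (L k) 0) (nth 0 (L k) 1) :: pref L k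
  else [::].

Definition word (L : nat -> seq nat) (n : nat) : nat := head 0 (pref L n.+1).

Lemma prefS L n : pref L n.+1 = word L n :: pref L n.
Proof. by []. Qed.

Lemma size_pref L n : size (pref L n) = n.
Proof. by elim: n => //= n ->. Qed.

Lemma rev_pref L n : rev (pref L n) = mkseq (word L) n.
Proof. by elim: n => // n IH; rewrite prefS rev_cons IH -mkseqS. Qed.

Lemma onth_pref L n p : p < n -> onth (pref L n) p = Some (word L (n - p.+1)).
Proof.
elim: n p => // n IH [|p] lt_p; rewrite prefS /=; first by rewrite subn1.
by rewrite IH // subSS.
Qed.

Lemma good_pref L n :
  (forall k, nth 0 (L k) 0 != nth 0 (L k) 1) -> good (pref L n).
Proof. by move=> h; elim: n => [|n IH]; [exact: good_nil | exact: good_choice]. Qed.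

Lemma run_pref L i p t : 0 < p ->
  (forall s, s < t -> word L (i + p + s) = word L (i + s)) ->
  t <= run p (pref L (i + p + t)).
Proof.
move=> p0; elim: t => // t IH h; rewrite addnS prefS [run _ _]/=.
rewrite onth_pref; last by lia.
have -> : i + p + t - p.-1.+1 = i + t by lia.
by rewrite h // eqxx ltnS; apply: IH => s lt_s; apply: h; lia.
Qed.

Lemma cube_free_word L :
  (forall k, nth 0 (L k) 0 != nth 0 (L k) 1) -> cube_free (word L).
Proof.
move=> h s [i [n ->]] [u nu E].
have u0 : 0 < size u by case: u nu {E}.
have En : n = size u + (size u + size u).
  by have := congr1 size E; rewrite size_mkseq !size_cat.
have nth_s t : t < n -> nth 0 (u ++ u ++ u) t = word L (i + t).
  by move=> lt_t; rewrite -E nth_mkseq.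
(* This prefix ends with the cube, whose last two thirds repeat the letters [size u] places
   earlier. *)
have [nc _ _] := @good_pref L (i + size u + (size u).*2) h.
have := nc (size u) u0; rewrite ltnNge => /negP; apply.
apply: run_pref => // t lt_t.
rewrite -addnA -!nth_s; [|lia|lia].
rewrite nth_cat [RHS]nth_cat; case: ifPn => [|_]; first by lia.
rewrite addKn nth_cat; case: ifPn => // nlt; rewrite nth_cat ifT //; lia.
Qed.

Lemma size_letters (B : {fset nat}) : size (letters B) = #|` B|.
Proof. by rewrite size_sort. Qed.

Lemma letters_neq (B : {fset nat}) :
  #|` B| = 2 -> nth 0 (letters B) 0 != nth 0 (letters B) 1.
Proof.
move=> sz; rewrite nth_uniq ?size_letters ?sz //.
by rewrite sort_uniq fset_uniq.
Qed.

Lemma word_mem L (A : nat -> {fset nat}) n :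
  (forall i, L i = letters (A i)) -> (forall i, #|` A i| = 2) -> word L n \in A n.
Proof.
move=> LE sz; have mem k : k < 2 -> nth 0 (L n) k \in A n.
  move=> lt2; have: nth 0 (L n) k \in letters (A n).
    by rewrite LE mem_nth // size_letters sz.
  by rewrite mem_sort.
by rewrite /word /= /choice; case: ifP => _; exact: mem.
Qed.

(** * Programs for the random access machine *)

(** [Q] has to hold at some moment up to [T], so bounds can be relaxed although the machine may run
    on. *)
Definition goes (P : program) (x : config) (T : nat) (Q : config -> Prop) :=
  exists2 t, t <= T & Q (iter t (step P) x).

Lemma goes0 P x T (Q : config -> Prop) : Q x -> goes P x T Q.
Proof. by move=> qx; exists 0. Qed.

Lemma goesS P x T (Q : config -> Prop) :
  goes P (step P x) T Q -> goes P x T.+1 Q.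
Proof. by case=> t le_t q; exists t.+1; rewrite ?iterSr. Qed.

Lemma goes_bind P x T1 T2 (Q1 Q : config -> Prop) :
  goes P x T1 Q1 -> (forall y, Q1 y -> goes P y T2 Q) -> goes P x (T1 + T2) Q.
Proof.
case=> t le_t q1 h; have [s le_s q] := h _ q1.
by exists (s + t); [rewrite addnC leq_add | rewrite iterD].
Qed.

Lemma goes_leq P x T1 T2 (Q : config -> Prop) :
  T1 <= T2 -> goes P x T1 Q -> goes P x T2 Q.
Proof. by move=> le_T [t le_t q]; exists t => //; apply: leq_trans le_T. Qed.

(* Code is a function of the address at which it is placed. *)
Definition code : Type := nat -> program.

Definition placed (P : program) (a : nat) (l : program) : Prop :=
  forall i x, onth l i = Some x -> onth P (a + i) = Some x.

Definition ends (c : code) (a : nat) (Q : (nat -> nat) -> Prop) (y : config) :=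
  pc y = a + size (c a) /\ Q (Defs.mem y).

(** The precondition is one concrete memory [m], about which hypotheses are made outside;
    quantifying over [P] and [a] lets the code be placed in any program. *)
Definition hoare (c : code) (m : nat -> nat) (T : nat) (Q : (nat -> nat) -> Prop) :=
  forall P a, placed P a (c a) -> goes P (Config a m) T (ends c a Q).

(* As [hoare], for a halting time without explicit bound. *)
Definition hoareu (c : code) (m : nat -> nat) (Q : (nat -> nat) -> Prop) :=
  forall P a, placed P a (c a) -> exists T, goes P (Config a m) T (ends c a Q).

Definition seqc (c d : code) : code := fun a => c a ++ d (a + size (c a)).

Definition block (l : program) : code := fun _ => l.

Definition is_jump (i : instr) : bool := if i is Jpos _ _ then true else false.

(** The unconditional jump over [c] is made by setting register 0 to 1 and testing it, so this
    register is scratch throughout. *)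
Definition ifc (r : nat) (c d : code) : code := fun a =>
  let ac := a + size (d a.+1) + 3 in
  Jpos r ac :: d a.+1 ++ [:: Const 0 1; Jpos 0 (ac + size (c ac))] ++ c ac.

(** The test stands behind the body and is jumped to first, so a zero counter skips the body. *)
Definition loop (r : nat) (c : code) : code := fun a =>
  [:: Const 0 1; Jpos 0 (a.+2 + size (c a.+2))] ++ c a.+2 ++
  [:: Jpos r a.+2].

Lemma placed_cat P a l1 l2 :
  placed P a (l1 ++ l2) -> placed P a l1 /\ placed P (a + size l1) l2.
Proof.
move=> h; split=> i x e.
  by apply: h; rewrite onth_cat -onthTE e.
by rewrite -addnA; apply: h; rewrite onth_cat ltnNge leq_addr addKn.
Qed.

Lemma placed_cons P a i l :
  placed P a (i :: l) -> onth P a = Some i /\ placed P a.+1 l.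
Proof.
move=> h; split; first by rewrite -[a]addn0; apply: h.
by move=> j x e; rewrite addSnnS; apply: h.
Qed.

Lemma goes_instr P a m i T Q : onth P a = Some i ->
  goes P (exec i (Config a m)) T Q -> goes P (Config a m) T.+1 Q.
Proof. by move=> e h; apply: goesS; rewrite /step /= e. Qed.

Lemma goes_jump P a m r l T Q : onth P a = Some (Jpos r l) ->
  goes P (Config (if 0 < m r then l else a.+1) m) T Q ->
  goes P (Config a m) T.+1 Q.
Proof. by move=> e h; apply: goes_instr e _; rewrite /=; case: ifP h. Qed.

Lemma hoare_leq c m T1 T2 (Q1 Q2 : (nat -> nat) -> Prop) :
  T1 <= T2 -> hoare c m T1 Q1 -> (forall m', Q1 m' -> Q2 m') -> hoare c m T2 Q2.
Proof.
move=> le_T h imp P a /h; case=> t le_t [e q].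
by exists t; [apply: leq_trans le_T | split; [|apply: imp]].
Qed.

Lemma hoare_seq c d m T1 T2 Q1 Q2 :
  hoare c m T1 Q1 -> (forall m1, Q1 m1 -> hoare d m1 T2 Q2) ->
  hoare (seqc c d) m (T1 + T2) Q2.
Proof.
move=> hc hd P a /placed_cat[pl_c pl_d]; apply: goes_bind (hc _ _ pl_c) _.
case=> [k m1] [/= -> q1]; case: (hd _ q1 _ _ pl_d) => t le_t [e q].
by exists t => //; split=> //; rewrite e /seqc size_cat addnA.
Qed.

Definition effect (m : nat -> nat) (i : instr) : nat -> nat :=
  Defs.mem (exec i (Config 0 m)).

Lemma hoare_block l m (Q : (nat -> nat) -> Prop) :
  all (fun i => ~~ is_jump i) l -> Q (foldl effect m l) ->
  hoare (block l) m (size l) Q.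
Proof.
move=> nj q P a; rewrite /block /ends.
elim: l a m nj q => [|i l IH] a m /=.
  by move=> _ q _; apply: goes0; rewrite addn0.
case/andP=> nj nl q /placed_cons[e pl]; apply: goes_instr e _.
have -> : exec i (Config a m) = Config a.+1 (effect m i) by case: i nj {q}.
by rewrite -addSnnS; apply: IH.
Qed.

Lemma hoare_if r c d m T Q :
  (0 < m r -> hoare c m T Q) ->
  (m r = 0 -> hoare d m T (fun m' => Q (upd m' 0 1))) ->
  hoare (ifc r c d) m (T + 3) Q.
Proof.
move=> hc hd P a; rewrite /ifc /ends /=; set ac := a + _ + 3.
case/placed_cons=> e0 /placed_cat[pl_d].
case/placed_cons=> e1 /placed_cons[e2]; rewrite !addSn => pl_c.
have Eac : ac = (a + size (d a.+1)).+3 by rewrite /ac addn3.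
have -> : a + (size (d a.+1 ++ [:: Const 0 1, Jpos 0 (ac + size (c ac)) & c ac])).+1
          = ac + size (c ac) by rewrite size_cat /=; lia.
rewrite addnC; apply: (@goes_leq _ _ (T + 2).+1); first by lia.
apply: goes_jump e0 _.
case: posnP => [m0|m_gt0]; last first.
  apply: (@goes_leq _ _ T); first by lia.
  have pl : placed P ac (c ac) by rewrite {1}Eac.
  exact: hc m_gt0 _ _ pl.
apply: goes_bind (hd m0 _ _ pl_d) _ => -[k m'] [/= -> q].
apply: goes_instr e1 _; apply: goes_jump e2 _ => /=.
by apply: goes0; split.
Qed.

Lemma hoare_exu c m T Q : hoare c m T Q -> hoareu c m Q.
Proof. by move=> h P a /h; exists T. Qed.

Lemma hoareu_seq c d m Q1 Q2 :
  hoareu c m Q1 -> (forall m1, Q1 m1 -> hoareu d m1 Q2) -> hoareu (seqc c d) m Q2.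
Proof.
move=> hc hd P a /placed_cat[pl_c pl_d]; have [T [t le_t]] := hc _ _ pl_c.
(* The bound for [d] depends on the memory that [c] actually leaves, so the intermediate
   configuration is fixed before [T2] is chosen. *)
case E: (iter _ _ _) => [k m1] [/= Ek q1].
have [T2 [t2 le_t2 [e2 q2]]] := hd _ q1 _ _ pl_d.
exists (T + T2); apply: (@goes_bind _ _ _ _ (fun y => y = Config k m1)).
  by exists t.
by move=> y ->; rewrite Ek; exists t2 => //; split; rewrite // e2 size_cat addnA.
Qed.

Section Loop.
Variables (r : nat) (c : code) (I : nat -> (nat -> nat) -> Prop).
Hypothesis counter : forall k m, I k m -> m r = k.

(** Each round costs one test besides the body; the other 3 steps are the two instructions of entry
    and the final test. *)
Lemma hoare_loop k m T :
  (forall j m, I j.+1 m -> hoare c m T (I j)) -> I k (upd m 0 1) ->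
  hoare (loop r c) m (k * T.+1 + 3) (I 0).
Proof.
move=> body i0 P a; rewrite /loop /ends /=.
case/placed_cons=> e0 /placed_cons[e1] /placed_cat[].
move=> pl_c /placed_cons[e2 _].
rewrite addn3; apply: goes_instr e0 _; apply: goes_jump e1 _ => /=.
move: (upd m 0 1) i0; elim: k => [|k IH] {}m i0.
  apply: goes_jump e2 _; rewrite (counter i0) /=; apply: goes0.
  by rewrite /= size_cat addn1 !addnS.
apply: goes_jump e2 _; rewrite (counter i0) /=.
apply: (@goes_leq _ _ (T + (k * T.+1).+1)); first by lia.
by apply: goes_bind (body _ _ i0 _ _ pl_c) _ => -[k' m'] [/= ->]; apply: IH.
Qed.

Lemma hoareu_loop k m :
  (forall j m, I j.+1 m -> hoareu c m (I j)) -> I k (upd m 0 1) ->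
  hoareu (loop r c) m (I 0).
Proof.
move=> body i0 P a; rewrite /loop /ends /=.
case/placed_cons=> e0 /placed_cons[e1] /placed_cat[].
move=> pl_c /placed_cons[e2 _].
suff [T h] : exists T, goes P (Config (a.+2 + size (c a.+2)) (upd m 0 1)) T
    (fun y => pc y = (a.+2 + size (c a.+2)).+1 /\ I 0 (Defs.mem y)).
  exists T.+2; apply: goes_instr e0 _; apply: goes_jump e1 _ => /=.
  have -> : a + (size (c a.+2 ++ [:: Jpos r a.+2])).+2 = (a.+2 + size (c a.+2)).+1.
    by rewrite size_cat /=; lia.
  exact: h.
move: (upd m 0 1) i0; elim: k => [|k IH] {}m i0.
  exists 1; apply: goes_jump e2 _; rewrite (counter i0) /=; exact: goes0.
have [T [t le_t]] := body _ _ i0 _ _ pl_c.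
case E: (iter _ _ _) => [k' m'] [/= Ek' i1]; have [T' h] := IH _ i1.
exists (T + T').+1; apply: goes_jump e2 _; rewrite (counter i0) /=.
apply: (@goes_bind _ _ _ _ (fun y => y = Config k' m')); first by exists t.
by move=> y ->; rewrite Ek'.
Qed.

End Loop.

(** * Frame conditions and words in memory *)

Definition same (S : seq nat) (m m' : nat -> nat) : Prop :=
  forall j, j \notin S -> m' j = m j.

(** [Store] is rejected, because its target depends on the memory. *)
Definition writes_in (S : seq nat) (i : instr) : bool :=
  match i with
  | Const d _ | Add d _ _ | Sub d _ _ | Fetch d _ => d \in S
  | _ => false
  end.

Lemma same_trans S m1 m2 m3 : same S m1 m2 -> same S m2 m3 -> same S m1 m3.
Proof. by move=> h12 h23 j nj; rewrite h23 // h12. Qed.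

Lemma same_sub (S S' : seq nat) m m' : {subset S <= S'} -> same S m m' -> same S' m m'.
Proof. by move=> sub h j nj; apply: h; apply: contra nj; apply: sub. Qed.

Lemma same_upd (S : seq nat) m m' d v : d \in S -> same S m m' -> same S m (upd m' d v).
Proof. by move=> dS h j nj; rewrite /upd; case: eqP nj => [->|_ /h //]; rewrite dS. Qed.

Lemma same_block S m m' l : all (writes_in S) l ->
  same S m m' -> same S m (foldl effect m' l).
Proof.
elim: l m' => // i l IH m' /= /andP[wi wl] h; apply: IH wl _.
by case: i wi => //= *; apply: same_upd.
Qed.

Lemma upd_eq m d v : upd m d v d = v.
Proof. by rewrite /upd eqxx. Qed.

Lemma upd_neq m d v j : j != d -> upd m d v j = m j.
Proof. by rewrite /upd => /negbTE->. Qed.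

(* [u] is the word stored from address [B] on, most recent letter first. *)
Definition stores (B : nat) (u : seq nat) (m : nat -> nat) : Prop :=
  forall i, i < size u -> m (B + i) = nth 0 u (size u - i.+1).

Lemma stores_same S B u m m' : same S m m' ->
  (forall i, i < size u -> B + i \notin S) -> stores B u m -> stores B u m'.
Proof. by move=> h nS st i lt_i; rewrite h ?nS // st. Qed.

(** * Machine code for runs and scores *)

(* Registers: 0 scratch for jumps, 1 length of the word, 2 the constant 1,
   3 address of the word, 4 and 5 the two letters, 6 length of the extended word,
   7 period, 8 run length, 9 loop counter, 10 and 11 pointers, 12 to 17 scratch,
   18 score, 19 address of the new letter, 20 result. *)
Definition run_init : program :=
  [:: Sub 9 6 7; Const 8 0; Const 10 0; Add 10 10 3; Add 11 3 7].
(** The sum of both truncated differences vanishes iff the two letters agree. *)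
Definition run_compare : program :=
  [:: Fetch 12 10; Fetch 13 11; Sub 14 12 13; Sub 15 13 12; Add 14 14 15].
Definition run_next : program := [:: Add 10 10 2; Add 11 11 2; Sub 9 9 2].

Definition run_code : code :=
  seqc (block run_init)
    (loop 9 (seqc (block run_compare)
      (seqc (ifc 14 (block [:: Const 8 0]) (block [:: Add 8 8 2]))
        (block run_next)))).

Definition run_regs : seq nat := [:: 0; 8; 9; 10; 11; 12; 13; 14; 15].

(** The word is scanned from its oldest letter: with [k] rounds left, all but the last [k] letters
    have been processed. The scan starts with [p] letters, where the run is 0. If [p] exceeds the
    length there is no round and the second pointer starts behind the word, hence the condition
    [0 < k]. *)
Definition run_inv B p u m k m' : Prop :=
  [/\ k <= size u - p, m' 9 = k, m' 8 = run p (drop k u),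
      0 < k -> m' 10 = B + (size u - p - k) /\ m' 11 = B + (size u - k)
    & same run_regs m m'].

Lemma hoare_run_code B p u m : 20 < B -> 0 < p ->
  m 2 = 1 -> m 3 = B -> m 6 = size u -> m 7 = p -> stores B u m ->
  hoare run_code m (14 * size u + 8)
    (fun m' => m' 8 = run p u /\ same run_regs m m').
Proof.
move=> leB p0 m2 m3 m6 m7 hw.
have hi j : B + j \notin run_regs by rewrite !inE; lia.
have body k m' : run_inv B p u m k.+1 m' ->
    hoare (seqc (block run_compare)
      (seqc (ifc 14 (block [:: Const 8 0]) (block [:: Add 8 8 2]))
        (block run_next))) m' (5 + (1 + 3 + 3)) (run_inv B p u m k).
  case=> le_k h9 h8 /(_ isT)[h10 h11] sm.
  have lt_k : k < size u by lia.
  have E1 : m' (B + (size u - p - k.+1)) = nth 0 u (k + p).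
    rewrite sm // hw; last by lia.
    by congr nth; lia.
  have E2 : m' (B + (size u - k.+1)) = nth 0 u k.
    rewrite sm // hw; last by lia.
    by congr nth; lia.
  set d := (nth 0 u (k + p) - nth 0 u k) + (nth 0 u k - nth 0 u (k + p)).
  have d0 : (d == 0) = (nth 0 u (k + p) == nth 0 u k) by rewrite /d; lia.
  apply: (hoare_seq (Q1 := fun m1 => [/\ m1 14 = d, m1 8 = m' 8, m1 9 = m' 9,
    (m1 10 = m' 10 /\ m1 11 = m' 11) & same run_regs m m1])).
    apply: hoare_block => //; split=> //; last by apply: same_block.
    rewrite /= /effect /=; rewrite /upd /=.
    rewrite h10 h11 E1 (_ : (B + _ == 12) = false) ?E2 //; lia.
  move=> m1 [h14 g8 g9 [g10 g11] sm1].
  have m12 : m1 2 = 1 by rewrite sm1.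
  have dropE : drop k u = nth 0 u k :: drop k.+1 u by rewrite (drop_nth 0).
  have onthE : onth (drop k.+1 u) p.-1 = Some (nth 0 u (k + p)).
    rewrite onthE (nth_map 0) ?nth_drop ?size_drop; last by lia.
    by congr (Some (nth _ _ _)); lia.
  have runE : run p (drop k u) = if d == 0 then (run p (drop k.+1 u)).+1 else 0.
    by rewrite dropE [run _ _]/= onthE d0.
  apply: (hoare_seq (Q1 := fun m2 => [/\ m2 8 = run p (drop k u), m2 9 = m' 9,
    (m2 10 = m' 10 /\ m2 11 = m' 11) & same run_regs m m2])).
    rewrite runE; apply: hoare_if; rewrite h14 => hd.
      have sm2 : same run_regs m (foldl effect m1 [:: Const 8 0]).
        exact: same_block.
      by apply: (@hoare_block [:: _]) => //; rewrite gtn_eqF.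
    have sm2 : same run_regs m (upd (foldl effect m1 [:: Add 8 8 2]) 0 1).
      by apply: same_upd => //; apply: same_block.
    apply: (@hoare_block [:: _]) => //; rewrite hd eqxx; split=> //.
    by rewrite /= /effect /= /upd /= g8 h8 m12 addn1.
  move=> m2' [k8 k9 [k10 k11] sm2]; have n2 : m2' 2 = 1 by rewrite sm2.
  have sm3 : same run_regs m (foldl effect m2' run_next) by exact: same_block.
  apply: hoare_block => //; split=> //; first by lia.
  - by rewrite /= /effect /= /upd /= n2 k9 h9 subn1.
  - move=> k0; rewrite /= /effect /= /upd /= n2 k10 k11 h10 h11; lia.
apply: (@hoare_leq _ _ (5 + ((size u - p) * 13 + 3)) _
    (run_inv B p u m 0)); first by lia.
  apply: hoare_seq.
    apply: (@hoare_block _ _ (fun m' => m' = foldl effect m run_init)) => //.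
  move=> m1 ->; apply: (hoare_loop (I := run_inv B p u m)) => //.
    by move=> k m' [].
  have sm1 : same run_regs m (upd (foldl effect m run_init) 0 1).
    by apply: same_upd => //; apply: same_block.
  split=> //; rewrite /= /effect /= /upd /= ?m3 ?m6 ?m7 //.
    by rewrite run_oversize // size_drop; lia.
  by move=> lt0; split; lia.
by move=> m' [_ _ -> _ sm]; rewrite drop0.
Qed.

(* Evaluates the registers after a straight-line block; [simpl] is
   exponential there. *)
Ltac regs := rewrite /effect;
  lazy -[addn subn muln expn double run term score total_score coef size choice
         nth same].

(** Machine subtraction truncates as on [nat], so [coef p], [e] and [1 - e] are computed
    literally. *)
Definition term_init : program :=
  [:: Add 14 7 7; Sub 14 14 8; Sub 15 2 14;
      Const 16 6; Const 17 3; Sub 17 17 7; Add 16 16 17; Add 16 16 17;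
      Const 17 2; Sub 17 17 7; Add 16 16 17; Add 16 16 15;
      Const 12 4; Add 17 6 12; Add 17 17 17; Sub 17 17 14].
Definition times3 : program := [:: Add 12 16 16; Add 16 16 12; Sub 14 14 2].
Definition times4 : program := [:: Add 16 16 16; Add 16 16 16; Sub 17 17 2].

Definition term_code : code :=
  seqc (block term_init)
    (seqc (loop 14 (block times3))
      (seqc (loop 17 (block times4))
        (block [:: Add 18 18 16; Sub 7 7 2]))).

Definition term_regs : seq nat := [:: 0; 7; 12; 14; 15; 16; 17; 18].
Definition pow_regs : seq nat := [:: 0; 12; 14; 15; 16; 17].

Lemma hoare_times3 m e : m 2 = 1 -> m 14 = e ->
  hoare (loop 14 (block times3)) m (e * 4 + 3)
    (fun m' => [/\ m' 16 = m 16 * 3 ^ e, m' 17 = m 17 & same pow_regs m m']).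
Proof.
move=> m2 m14.
apply: (hoare_leq (leqnn _) (hoare_loop (I := fun k m' => [/\ m' 14 = k,
  m' 16 * 3 ^ k = m 16 * 3 ^ e, m' 17 = m 17 & same pow_regs m m']) _ _ _)).
- by move=> k m' [].
- move=> k m' [h14 h16 h17 sm].
  have sm1 : same pow_regs m (foldl effect m' times3) by apply: same_block.
  have h2 : m' 2 = 1 by rewrite sm.
  apply: (@hoare_block times3) => //; split=> //; rewrite /= /effect /= /upd /=.
    by rewrite h14 h2 subn1.
  by rewrite -h16 expnS; lia.
- have sm1 : same pow_regs m (upd m 0 1) by apply: same_upd.
  by split=> //; rewrite /upd /= m14.
- by move=> m' [_ <- h17 sm]; rewrite muln1.
Qed.

Lemma hoare_times4 m e : m 2 = 1 -> m 17 = e ->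
  hoare (loop 17 (block times4)) m (e * 4 + 3)
    (fun m' => m' 16 = m 16 * 4 ^ e /\ same pow_regs m m').
Proof.
move=> m2 m14.
apply: (hoare_leq (leqnn _) (hoare_loop (I := fun k m' => [/\ m' 17 = k,
  m' 16 * 4 ^ k = m 16 * 4 ^ e & same pow_regs m m']) _ _ _)).
- by move=> k m' [].
- move=> k m' [h14 h16 sm].
  have sm1 : same pow_regs m (foldl effect m' times4) by apply: same_block.
  have h2 : m' 2 = 1 by rewrite sm.
  apply: (@hoare_block times4) => //; split=> //; rewrite /= /effect /= /upd /=.
    by rewrite h14 h2 subn1.
  by rewrite -h16 expnS; lia.
- have sm1 : same pow_regs m (upd m 0 1) by apply: same_upd.
  by split=> //; rewrite /upd /= m14.
- by move=> m' [_ <- sm]; rewrite muln1.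
Qed.

Lemma hoare_term_code p s u m : p <= size u + 4 ->
  m 2 = 1 -> m 6 = size u -> m 7 = p -> m 8 = run p u -> m 18 = s ->
  hoare term_code m (16 * size u + 100)
    (fun m' => [/\ m' 18 = s + term (size u + 4).*2 u p, m' 7 = p.-1
                 & same term_regs m m']).
Proof.
move=> le_p m2 m6 m7 m8 m18; set N := (size u + 4).*2.
set e := p.*2 - run p u.
have sub : {subset pow_regs <= term_regs} by move=> j; rewrite !inE; lia.
apply: (@hoare_leq _ _ (16 + ((e * 4 + 3) + (((N - e) * 4 + 3) + 2))) _ _ _ _ _
  (fun m' => id)).
  by rewrite /e /N; lia.
have sm1 : same pow_regs m (foldl effect m term_init) by apply: same_block.
apply: (hoare_seq (Q1 := fun m1 => [/\ m1 14 = e, m1 16 = coef p + (1 - e),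
    m1 17 = N - e & same pow_regs m m1])).
  apply: (@hoare_block term_init) => //; split=> //.
  - by regs; rewrite m7 m8 addnn.
  - by regs; rewrite m7 m8 m2 /coef /e; lia.
  - by regs; rewrite m7 m8 m6 !addnn.
move=> {sm1} m1 [g14 g16 g17 sm1].
apply: (hoare_seq (Q1 := fun m' => [/\ m' 16 = m1 16 * 3 ^ e, m' 17 = N - e
    & same pow_regs m m'])).
  apply: hoare_leq (hoare_times3 _ g14) _ => //; first by rewrite sm1.
  by move=> m' [-> -> sm]; split=> //; exact: same_trans sm1 sm.
move=> {sm1} m2' [h16 h17 sm2].
apply: (hoare_seq (Q1 := fun m' => m' 16 = m2' 16 * 4 ^ (N - e) /\
    same pow_regs m m')).
  apply: hoare_leq (hoare_times4 _ h17) _ => //; first by rewrite sm2.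
  by move=> m' [-> sm]; split=> //; exact: same_trans sm2 sm.
move=> m3 [k16 sm3].
have sm4 : same term_regs m (foldl effect m3 [:: Add 18 18 16; Sub 7 7 2]).
  by apply: same_block => //; apply: same_sub sm3.
apply: hoare_block => //; split=> //; rewrite /= /effect /= /upd /=.
  by rewrite k16 h16 g16 sm3 // m18 /term -/e -mulnA.
by rewrite !sm3 // m7 m2 subn1.
Qed.

Definition total_code : code :=
  seqc (block [:: Const 18 0; Const 12 4; Add 7 6 12])
    (loop 7 (seqc run_code term_code)).

Definition total_regs : seq nat := 0 :: iota 7 12.

Definition total_time (n : nat) : nat := (n + 4) * (30 * n + 109) + 6.

Lemma hoare_total_code B u m : 20 < B -> m 2 = 1 -> m 3 = B -> m 6 = size u ->
  stores B u m ->
  hoare total_code m (total_time (size u))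
    (fun m' => m' 18 = total_score u /\ same total_regs m m').
Proof.
move=> leB m2 m3 m6 st; set M := size u + 4.
have hi (S : seq nat) j : {subset S <= total_regs} -> B + j \notin S.
  by move=> sub; apply/negP => /sub; rewrite !inE; lia.
have subR : {subset run_regs <= total_regs} by move=> j; rewrite !inE; lia.
have subT : {subset term_regs <= total_regs} by move=> j; rewrite !inE; lia.
pose I k m' := [/\ k <= M, m' 7 = k, m' 18 + score M.*2 k u = total_score u
                 & same total_regs m m'].
apply: (@hoare_leq _ _ (3 + (M * ((14 * size u + 8) + (16 * size u + 100)).+1 + 3)) _ (I 0)).
- by rewrite /total_time -/M; nia.
- apply: (hoare_seq (Q1 := fun m' =>
      m' = foldl effect m [:: Const 18 0; Const 12 4; Add 7 6 12])).
    exact: hoare_block.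
  move=> m1 ->; apply: (hoare_loop (I := I)).
  + by move=> k m' [].
  + move=> k m' [le_k h7 h18 sm].
    have st' : stores B u m' by apply: stores_same sm _ st => i _; apply: hi.
    apply: (hoare_seq (Q1 := fun m2 => m2 8 = run k.+1 u /\ same run_regs m' m2)).
      by apply: (@hoare_run_code B) => //; rewrite sm.
    move=> m2' [g8 sm2].
    have sm' : same total_regs m m2' by apply: same_trans sm (same_sub subR sm2).
    apply: (hoare_leq (leqnn _) (@hoare_term_code k.+1 (m' 18) u m2' _ _ _ _ _ _)) => //.
    * by rewrite sm'.
    * by rewrite sm'.
    * by rewrite sm2.
    * by rewrite sm2.
    move=> m3' [e18 e7 sm3]; split=> //; first exact: ltnW.
      by rewrite -h18 scoreS e18 -/M addnAC addnA.
    exact: same_trans sm' (same_sub subT sm3).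
  + have sm : same total_regs m
        (upd (foldl effect m [:: Const 18 0; Const 12 4; Add 7 6 12]) 0 1).
      by apply: same_upd => //; apply: same_block.
    by split=> //; rewrite /= /effect /= /upd /= m6.
- by move=> m' [_ _ <- sm]; rewrite addn0.
Qed.

(** * The greedy choice on the machine *)

Definition decide_code : code :=
  seqc (block [:: Add 6 1 2; Add 19 3 1; Store 19 4])
  (seqc total_code
  (seqc (block [:: Const 20 0; Add 20 20 18; Store 19 5])
  (seqc total_code
  (seqc (block [:: Sub 12 20 18; Const 20 0])
  (seqc (ifc 12 (block [:: Add 20 20 5]) (block [:: Add 20 20 4]))
        (block [:: Store 19 20])))))).

(** Together with the cell behind the word, where both letters are tried and the chosen one is
    finally left, these are all the registers that the choice may change. *)
Definition decide_regs : seq nat := 0 :: iota 6 15.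

Definition decide_time (n : nat) : nat := total_time n.+1 * 2 + 20.

Lemma stores_cons B u m x :
  stores B u m -> m (B + size u) = x -> stores B (x :: u) m.
Proof.
move=> st mx i /=; rewrite ltnS leq_eqVlt => /orP[/eqP->|lt_i].
  by rewrite mx subnn.
by rewrite st // subSn.
Qed.

Lemma hoare_decide_code B u x y m : 20 < B ->
  m 1 = size u -> m 2 = 1 -> m 3 = B -> m 4 = x -> m 5 = y -> stores B u m ->
  hoare decide_code m (decide_time (size u))
    (fun m' => [/\ m' 20 = choice u x y, m' (B + size u) = choice u x y
                 & same (B + size u :: decide_regs) m m']).
Proof.
move=> leB m1 m2 m3 m4 m5 st; set b := B + size u; set S := b :: decide_regs.
have subS : {subset total_regs <= S} by move=> j; rewrite !inE; lia.
have bS : b \in S by rewrite inE eqxx.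
have stS v m' : same S m m' -> m' b = v -> stores B (v :: u) m'.
  move=> sm e; apply: stores_cons => //; apply: stores_same sm _ st => i lt_i.
  rewrite !inE /b; lia.
have low j : j <= 20 -> (b == j) = false by rewrite /b; lia.
have Tot v m' : same S m m' -> m' 6 = (size u).+1 -> m' b = v ->
    hoare total_code m' (total_time (size u).+1)
      (fun m'' => m'' 18 = total_score (v :: u) /\ same total_regs m' m'').
  move=> sm e6 eb; apply: (@hoare_total_code B (v :: u)) => //.
  - by rewrite sm // !inE /b; lia.
  - by rewrite sm // !inE /b; lia.
  - exact: stS.
apply: (@hoare_leq _ _ (3 + (total_time (size u).+1 + (3 +
  (total_time (size u).+1 + (2 + ((1 + 3) + 1)))))) _ _ _ _ _ (fun m' => id)).
  by rewrite /decide_time; lia.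
have nb : b \notin total_regs by rewrite !inE /b; lia.
have lowb j : j <= 20 -> (j == b) = false by rewrite /b; lia.
apply: (hoare_seq (Q1 := fun m' => [/\ m' 6 = (size u).+1, m' 19 = b, m' b = x
    & same S m m'])).
  apply: hoare_block => //; rewrite /= /effect /=.
  rewrite !(upd_eq, upd_neq _ _ (isT : 3 != 6), upd_neq _ _ (isT : 1 != 6)) m1 m3 -/b.
  split; rewrite ?(upd_eq, upd_neq) ?lowb ?low // ?m1 ?m2 ?m4 ?addn1 //.
  by do !(apply: same_upd; first by rewrite !inE ?eqxx ?orbT).
move=> ma [a6 a19 ab sa]; apply: (hoare_seq (Q1 := fun m' =>
    [/\ m' 18 = total_score (x :: u), m' 6 = (size u).+1, m' 19 = b & same S m m'])).
  apply: hoare_leq (Tot x ma sa a6 ab) _ => // m' [e sm].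
  split=> //; rewrite ?sm //; exact: same_trans sa (same_sub subS sm).
move=> {ma a6 a19 ab sa} ma [a18 a6 a19 sa].
apply: (hoare_seq (Q1 := fun m' => [/\ m' 20 = total_score (x :: u),
    m' 6 = (size u).+1, m' 19 = b, m' b = y & same S m m'])).
  have e5 : ma 5 = y by rewrite sa ?inE ?lowb.
  apply: hoare_block => //; rewrite /= /effect /=.
  rewrite !(upd_neq _ _ (isT : 19 != 20)) a19.
  split; rewrite ?(upd_eq, upd_neq) ?lowb ?low //.
  by do !(apply: same_upd; first by rewrite !inE ?eqxx ?orbT).
move=> {ma a18 a6 a19 sa} ma [a20 a6 a19 ab sa].
apply: (hoare_seq (Q1 := fun m' => [/\ m' 18 = total_score (y :: u),
    m' 20 = total_score (x :: u), m' 19 = b & same S m m'])).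
  apply: hoare_leq (Tot y ma sa a6 ab) _ => // m' [e sm].
  split=> //; rewrite ?sm //; exact: same_trans sa (same_sub subS sm).
move=> {ma a20 a6 a19 ab sa} ma [a18 a20 a19 sa].
apply: (hoare_seq (Q1 := fun m' => [/\
    m' 12 = total_score (x :: u) - total_score (y :: u), m' 20 = 0, m' 19 = b & same S m m'])).
  have sm : same S m (foldl effect ma [:: Sub 12 20 18; Const 20 0]).
    by apply: same_block; rewrite //= !inE ?orbT.
  by apply: hoare_block => //; split=> //; regs; rewrite ?a18 ?a20.
move=> {ma a18 a20 a19 sa} ma [a12 a20 a19 sa].
have ma45 : ma 4 = x /\ ma 5 = y by split; rewrite sa ?inE ?lowb.
apply: (hoare_seq (Q1 := fun m' => [/\ m' 20 = choice u x y, m' 19 = b & same S m m'])).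
  rewrite /choice -subn_gt0; apply: hoare_if; rewrite a12 => lt.
    have sm : same S m (foldl effect ma [:: Add 20 20 5]).
      by apply: same_block; rewrite //= !inE ?orbT.
    by apply: (@hoare_block [:: _]) => //; rewrite lt; case: ma45 => _ <-;
      split=> //; regs; rewrite ?a20 ?a19 ?add0n.
  have sm : same S m (upd (foldl effect ma [:: Add 20 20 4]) 0 1).
    by apply: same_upd; rewrite ?inE ?orbT //; apply: same_block; rewrite //= !inE ?orbT.
  by apply: (@hoare_block [:: _]) => //; rewrite lt; case: ma45 => <- _;
    split=> //; regs; rewrite ?a20 ?a19 ?add0n.
move=> {ma a12 a20 a19 sa ma45} ma [a20 a19 sa].
apply: (@hoare_block [:: _]) => //; rewrite /= /effect /= a19 a20; split.
- by rewrite upd_neq ?lowb.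
- by rewrite /upd eqxx.
- exact: same_upd.
Qed.

Lemma iter_step_halted P t x : halted P x -> iter t (step P) x = x.
Proof.
move=> h; elim: t => //= t ->; rewrite /step onth_default //; exact: h.
Qed.

Lemma goes_outputs c s r T :
  goes (c 0) (init s) T
    (ends c 0 (fun m => m 0 = 1 /\ m 1 = r)) -> outputs_within (c 0) T s [:: r].
Proof.
case=> t le_t; rewrite /outputs_within -(subnK le_t) iterD.
case: (iter t _ _) => k m [/= e [m0 m1]].
by rewrite iter_step_halted /halted /= ?e //; split; rewrite // /output /= m0 /mkseq /= m1.
Qed.

(** * The polynomial-time machine for the next letter *)

(* Register 0 serves as the destination pointer, register 2 contains 1. *)
Definition save_regs (k : nat) : program :=
  flatten [seq [:: Add 0 0 2; Store 0 j] | j <- iota 3 k].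

Lemma save_regsP k m a : m 0 = a -> m 2 = 1 -> 3 + k <= a ->
  let m' := foldl effect m (save_regs k) in
  [/\ m' 0 = a + k, forall i, i < k -> m' (a + i.+1) = m (3 + i)
    & forall j, 0 < j -> ~~ (a < j <= a + k) -> m' j = m j].
Proof.
move=> m0 m2; elim: k => [|k IH] le_a m'.
  by rewrite addn0; split=> //; lia.
have [h0 hi hj] := IH (ltnW le_a).
have -> : m' = effect (effect (foldl effect m (save_regs k)) (Add 0 0 2)) (Store 0 (3 + k)).
  by rewrite /m' /save_regs -[X in iota 3 X]addn1 iotaD map_cat flatten_cat foldl_cat.
set m1 := foldl _ _ _ in h0 hi hj *.
rewrite /effect /= !(upd_eq, upd_neq _ _ (isT : 3 + k != 0)) h0 hj //; last by lia.
rewrite m2 addn1; split=> [|i|j j0 nj].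
- by rewrite upd_neq ?upd_eq ?addnS //; lia.
- rewrite ltnS leq_eqVlt => /orP[/eqP->|lt_i].
    rewrite addnS upd_eq hj //; lia.
  by rewrite !upd_neq ?hi //; lia.
- by rewrite !upd_neq ?hj //; lia.
Qed.

(* The input occupies the registers from 0 on, and [n + 3] is found in register 0.
   Moving the input to address 16 (n + 3) frees the low registers. *)
Definition quad : program := nseq 4 (Add 0 0 0).
Definition copy_init : program :=
  [:: Const 7 17; Sub 9 1 7; Const 10 21; Const 11 1; Add 11 11 0;
      Const 7 18; Sub 3 0 7].
Definition copy_body : program :=
  [:: Fetch 12 10; Store 11 12; Add 10 10 2; Add 11 11 2; Sub 9 9 2].
Definition get_letters : program :=
  [:: Add 7 3 1; Fetch 4 7; Add 7 7 2; Fetch 5 7].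
Definition return_code : program := [:: Const 0 1; Const 1 0; Add 1 1 20].

(** Register 2 is saved first, since it has to hold 1 before [save_regs] can advance its pointer.
    With registers 3 to 20 this moves 19 of the [n + 2] items; the loop copies the other [n - 17],
    from address 21 on. The target begins behind the input, so nothing is overwritten. *)
Definition relocate : code :=
  seqc (block (quad ++ [:: Store 0 2; Const 2 1] ++ save_regs 18))
  (seqc (block copy_init) (loop 9 (block copy_body))).

Definition next_letter : code :=
  seqc relocate
  (seqc (block get_letters) (seqc decide_code (block return_code))).

Lemma hoare_relocate m n : m 0 = n + 3 -> m 1 = n ->
  hoare relocate m (42 + (7 + (n * 6 + 3))) (fun m' =>
    [/\ m' 1 = n, m' 2 = 1, m' 3 = 16 * (n + 3)
      & forall i, i < n + 2 -> m' (16 * (n + 3) + i) = m (2 + i)]).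
Proof.
move=> m0 m1; have [b bE] : exists b, b = 16 * (n + 3) by exists (16 * (n + 3)).
rewrite -bE.
apply: (hoare_seq (Q1 := fun m' => [/\ m' 0 = b + 18, m' 1 = n, m' 2 = 1,
    forall i, i < 19 -> m' (b + i) = m (2 + i)
    & forall j, 21 <= j < b -> m' j = m j])).
  have sz : 42 = size (quad ++ [:: Store 0 2; Const 2 1] ++ save_regs 18) by [].
  rewrite [X in hoare _ _ X]sz; apply: hoare_block; first by [].
  rewrite foldl_cat (foldl_cat _ _ [:: Store 0 2; Const 2 1] (save_regs 18)).
  set m4 := foldl effect m quad.
  have e0 : m4 0 = b by rewrite /m4 /quad; regs; rewrite m0 bE; lia.
  have ej j : 0 < j -> m4 j = m j.
    move=> j0; apply: (@same_block [:: 0]) => //; rewrite !inE; lia.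
  have -> : foldl effect m4 [:: Store 0 2; Const 2 1] = upd (upd m4 b (m 2)) 2 1.
    by rewrite /effect /= e0 ej.
  set m5 := upd _ 2 1.
  have low j : j < 21 -> (j == b) = false by lia.
  have high j : j < 21 -> (b == j) = false by lia.
  have [||| h0 hi hj] := @save_regsP 18 m5 b; rewrite /m5.
  - by rewrite !upd_neq ?low.
  - by rewrite upd_eq.
  - by lia.
  rewrite -/m5; split=> //.
  - by rewrite hj /m5 ?upd_neq ?low ?ej //; lia.
  - by rewrite hj /m5 ?upd_eq //; lia.
  - move=> [|i] lt_i; last first.
      rewrite hi // /m5 !upd_neq ?ej //; lia.
    by rewrite addn0 hj /m5 1?upd_neq ?high ?upd_eq //; lia.
  - move=> j hj'; rewrite hj /m5; [|lia|lia].
    by rewrite !upd_neq ?ej //; lia.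
move=> ma [a0 a1 a2 lo hi].
pose I k m' := [/\ k <= n - 17, m' 9 = k, m' 1 = n /\ m' 2 = 1, m' 3 = b
  & [/\ 0 < k -> m' 10 = n + 4 - k /\ m' 11 = b + (n + 2 - k),
   forall i, i < n + 2 - k -> m' (b + i) = m (2 + i)
   & forall j, 21 <= j < b -> m' j = m j]].
apply: (@hoare_leq _ _ (7 + ((n - 17) * 6 + 3)) _ (I 0)); first by lia.
  apply: (hoare_seq (Q1 := fun m' => m' = foldl effect ma copy_init)).
    exact: hoare_block.
  move=> mb ->; apply: (hoare_loop (I := I)).
  - by move=> k m' [].
  - move=> k m' [le_k h9 [h1 h2] h3 [/(_ isT)[h10 h11] hlo hhi]].
    apply: (@hoare_block copy_body) => //.
    (* The source address lies between 21 and [b], where the memory is still the original one. *)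
    have n2 : m' (n + 4 - k.+1) = m (n + 4 - k.+1) by apply: hhi; lia.
    have E : m (n + 4 - k.+1) = m (2 + (n + 2 - k.+1)) by congr m; lia.
    rewrite /effect /= !(upd_neq _ _ (isT : 11 != 12)) !upd_eq h10 h11 n2 E.
    rewrite ?[upd _ _ _ 10]upd_neq ?[upd _ _ _ 11]upd_neq ?[upd _ _ _ 9]upd_neq
      ?[upd _ _ _ 2]upd_neq; try lia.
    rewrite h2 h9 h10 h11; set a := b + (n + 2 - k.+1); set M := upd _ 9 _.
    have Ma : M a = m (2 + (n + 2 - k.+1)).
      by rewrite /M (@upd_neq _ 9) ?(@upd_neq _ 11) ?(@upd_neq _ 10) ?upd_eq // /a; lia.
    have Mo j : 12 < j \/ j < 9 -> j != a -> M j = m' j.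
      by move=> hj nj; rewrite /M !upd_neq //; lia.
    split; first by lia.
    + by rewrite /M upd_eq subn1.
    + by rewrite !Mo // /a; lia.
    + by rewrite Mo // /a; lia.
    split.
    + by move=> k0; rewrite /M ?(upd_eq, upd_neq) //; lia.
    + move=> i lt_i; case: (eqVneq i (n + 2 - k.+1)) => [->|ni]; first exact: Ma.
      by rewrite Mo ?hlo // /a; lia.
    + by move=> j hj; rewrite Mo ?hhi // /a; lia.
  - have e9 : (foldl effect ma copy_init) 9 = n - 17 by regs; rewrite a1.
    have e3 : (foldl effect ma copy_init) 3 = b by regs; rewrite a0; lia.
    have e10 : (foldl effect ma copy_init) 10 = 21 by regs.
    have e11 : (foldl effect ma copy_init) 11 = b + 19 by regs; rewrite a0; lia.
    have so : same [:: 3; 7; 9; 10; 11] ma (foldl effect ma copy_init).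
      exact: same_block.
    move: (foldl effect ma copy_init) e9 e3 e10 e11 so => mc e9 e3 e10 e11 so.
    split; rewrite ?upd_neq //; try lia.
    + by rewrite !so.
    + split.
      * by move=> k0; rewrite ?upd_neq // e10 e11; lia.
      * move=> i lt_i; rewrite upd_neq; last by lia.
        by rewrite so ?lo //; [lia | rewrite !inE; lia].
      * move=> j hj; rewrite upd_neq; last by lia.
        by rewrite so ?hi // !inE; lia.
- move=> m' [_ _ [h1 h2] h3 [_ h _]]; split=> //; by rewrite subn0 in h.
Qed.

Lemma hoare_next_letter u x y : let s := size u :: rev u ++ [:: x; y] in
  hoare next_letter (nth 0 (size s :: s))
    (42 + (7 + (size u * 6 + 3)) + (4 + (decide_time (size u) + 3)))
    (fun m' => m' 0 = 1 /\ m' 1 = choice u x y).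
Proof.
move=> s; set n := size u; set b := 16 * (n + 3).
have szs : size s = n + 3 by rewrite /s /= size_cat size_rev /= !addnS addn0.
apply: hoare_seq; first by apply: (@hoare_relocate _ n) => //; rewrite /= szs.
move=> m1 [h1 h2 h3 h].
have st : stores b u m1.
  move=> i lt_i; rewrite h; last by lia.
  by rewrite add2n /= nth_cat size_rev lt_i nth_rev.
have hx : m1 (b + n) = x.
  by rewrite h ?add2n /= ?nth_cat ?size_rev ?ltnn ?subnn //; lia.
have hy : m1 (b + n + 1) = y.
  rewrite -addnA h; last by lia.
  by rewrite add2n /= nth_cat size_rev ltnNge leq_addr addKn.
apply: (hoare_seq (Q1 := fun m' => [/\ m' 4 = x, m' 5 = y & same [:: 4; 5; 7] m1 m'])).
  apply: (@hoare_block get_letters) => //; split; last exact: same_block.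
    rewrite /effect /= ?(upd_eq, upd_neq _ _ (isT : 4 != 5), upd_neq _ _ (isT : 4 != 7)).
    by rewrite h1 h3 -/b upd_neq ?hx // /b; lia.
  rewrite /effect /= !upd_eq.
  rewrite !(upd_neq _ _ (isT : 7 != 4), upd_eq, upd_neq _ _ (isT : 2 != 4), upd_neq _ _ (isT : 2 != 7)).
  by rewrite h1 h2 h3 -/b !upd_neq ?hy // /b; lia.
move=> m2' [g4 g5 sm].
apply: (hoare_seq (Q1 := fun m' => m' 20 = choice u x y)).
  apply: hoare_leq (@hoare_decide_code b u x y m2' _ _ _ _ _ _ _) _ => //.
  - by rewrite /b; lia.
  - by rewrite sm.
  - by rewrite sm.
  - by rewrite sm.
  - by apply: stores_same sm _ st => i _; rewrite !inE /b; lia.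
  - by move=> m' [].
by move=> m3 g20; apply: (@hoare_block return_code) => //; split; regs; rewrite ?g20.
Qed.

(** * Simulation of a machine in shifted memory *)

(* Register 21 holds the offset at which the memory of the simulated machine
   starts, register 22 the largest address written so far. *)
Definition addr (r a : nat) : program := [:: Const r a; Add r r 21].
Definition load (r a : nat) : program := addr r a ++ [:: Fetch r r].

(** Except for jumps, the absolute target address ends up in register 23 and the value in 24, so
    that one common tail performs the assignment. *)
Definition sim_core (i : instr) : program :=
  match i with
  | Const d c => addr 23 d ++ [:: Const 24 c]
  | Add d a b => load 23 a ++ load 24 b ++ [:: Add 24 23 24] ++ addr 23 d
  | Sub d a b => load 23 a ++ load 24 b ++ [:: Sub 24 23 24] ++ addr 23 d
  | Fetch d a => load 24 a ++ [:: Add 24 24 21; Fetch 24 24] ++ addr 23 d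
  | Store a b => load 24 b ++ load 23 a ++ [:: Add 23 23 21]
  | Jpos a _ => load 23 a
  end.

(** By truncated subtraction, adding [23 - 22] to register 22 yields the maximum of both. *)
Definition sim_tail : program := [:: Store 23 24; Sub 25 23 22; Add 22 22 25].

(* Padding all blocks to length 12 makes the jump targets computable. *)
Definition pad (k : nat) (l : program) : program :=
  nseq (k - size l) (Const 25 0) ++ l.

(** Every jump that leaves the simulated program is sent to the end of the code, hence [minn]. *)
Definition sim_block (base len : nat) (i : instr) : program :=
  match i with
  | Jpos a l => pad 11 (sim_core i) ++ [:: Jpos 23 (base + 12 * minn l len)]
  | _ => pad 12 (sim_core i ++ sim_tail)
  end.

Definition simulate (P : program) : code := fun base =>
  flatten [seq sim_block base (size P) i | i <- P].

Lemma size_sim_block base len i : size (sim_block base len i) = 12.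
Proof. by case: i. Qed.

Definition sim_regs : seq nat := [:: 22; 23; 24; 25].

(** The second clause confines the nonzero cells to a known finite range, which a loop can clear
    afterwards. *)
Definition sim_rel (o : nat) (m0 s m : nat -> nat) : Prop :=
  [/\ forall a, m (o + a) = s a, forall a, m 22 < o + a -> s a = 0
    & forall j, j < o -> j \notin sim_regs -> m j = m0 j].

Definition dest (s : nat -> nat) (i : instr) : nat :=
  match i with
  | Const d _ | Add d _ _ | Sub d _ _ | Fetch d _ => d
  | Store a _ => s a
  | Jpos _ _ => 0
  end.

Definition value (s : nat -> nat) (i : instr) : nat :=
  match i with
  | Const _ c => c
  | Add _ a b => s a + s b
  | Sub _ a b => s a - s b
  | Fetch _ a => s (s a)
  | Store _ b => s b
  | Jpos _ _ => 0
  end.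

Lemma effect_upd s i : ~~ is_jump i -> effect s i = upd s (dest s i) (value s i).
Proof. by case: i. Qed.

Lemma addrP o m r a : m 21 = o -> r != 21 ->
  let m' := foldl effect m (addr r a) in m' r = o + a /\ same [:: r] m m'.
Proof.
move=> h21 nr; split; last by apply: same_block; rewrite /= ?inE ?eqxx.
by rewrite /effect /= !upd_eq upd_neq 1?eq_sym // h21 addnC.
Qed.

Lemma loadP o m r a : m 21 = o -> r != 21 -> r < o ->
  let m' := foldl effect m (load r a) in
  m' r = m (o + a) /\ same [:: r] m m'.
Proof.
move=> h21 nr lt_r; rewrite /load foldl_cat.
have [h sm] := addrP a h21 nr; set m1 := foldl _ _ _ in h sm *.
split; last by apply: same_block; rewrite /= ?inE ?eqxx.
by rewrite /effect /= upd_eq h sm // inE; lia.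
Qed.

Lemma load2P o s m a b : 26 < o -> m 21 = o -> (forall a, m (o + a) = s a) ->
  let m1 := foldl effect (foldl effect m (load 23 a)) (load 24 b) in
  [/\ m1 23 = s a, m1 24 = s b & m1 21 = o].
Proof.
move=> lo h21 hs m1.
have [||h1 s1] := @loadP o m 23 a h21; [by []|lia|].
have e21 : foldl effect m (load 23 a) 21 = o by rewrite s1.
have [||h2 s2] := @loadP o _ 24 b e21; [by []|lia|].
split; rewrite /m1; [by rewrite s2 // h1 hs | | by rewrite s2].
by rewrite h2 s1 ?hs // inE; lia.
Qed.

Lemma sim_coreP o s m i : 26 < o -> m 21 = o -> (forall a, m (o + a) = s a) ->
  ~~ is_jump i -> let m' := foldl effect m (sim_core i) in
  [/\ m' 23 = o + dest s i, m' 24 = value s i & same [:: 23; 24] m m'].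
Proof.
move=> lo h21 hs nj m'.
have so : same [:: 23; 24] m m' by apply: same_block => //; case: i nj {m'}.
suff: m' 23 = o + dest s i /\ m' 24 = value s i by case.
rewrite /m'; clear so m'; case: i nj => // [d c|d a b|d a b|d a|a b] _; rewrite /sim_core /dest /value.
- rewrite (foldl_cat _ _ (addr 23 d) [:: _]); have [h sm] := addrP d h21 (isT : 23 != 21).
  move: (foldl effect m (addr 23 d)) h sm => m1 h sm.
  by rewrite /effect /= upd_eq upd_neq.
- rewrite 3!foldl_cat; have [h1 h2 h3] := load2P a b lo h21 hs.
  move: (foldl _ (foldl _ _ _) _) h1 h2 h3 => m1 h1 h2 h3.
  set m2 := foldl effect m1 _; have e21 : m2 21 = o by rewrite /m2 /effect /= upd_neq.
  have e24 : m2 24 = s a + s b by rewrite /m2 /effect /= upd_eq h1 h2.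
  by have [-> sm] := addrP d e21 (isT : 23 != 21); rewrite sm.
- rewrite 3!foldl_cat; have [h1 h2 h3] := load2P a b lo h21 hs.
  move: (foldl _ (foldl _ _ _) _) h1 h2 h3 => m1 h1 h2 h3.
  set m2 := foldl effect m1 _; have e21 : m2 21 = o by rewrite /m2 /effect /= upd_neq.
  have e24 : m2 24 = s a - s b by rewrite /m2 /effect /= upd_eq h1 h2.
  by have [-> sm] := addrP d e21 (isT : 23 != 21); rewrite sm.
- rewrite 2!foldl_cat; have [||h1 s1] := @loadP o m 24 a h21; [by []|lia|].
  move: (foldl _ _ (load 24 a)) h1 s1 => m1 h1 s1.
  set m2 := foldl effect m1 _; have e21 : m2 21 = o by rewrite /m2 /effect /= !upd_neq // s1.
  have e24 : m2 24 = s (s a).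
    rewrite /m2 /effect /= !upd_eq h1 hs upd_neq ?s1 //= ?inE ?h21 1?addnC ?hs //; lia.
  by have [-> sm] := addrP d e21 (isT : 23 != 21); rewrite sm.
- rewrite 2!foldl_cat; have [||h1 s1] := @loadP o m 24 b h21; [by []|lia|].
  move: (foldl _ _ (load 24 b)) h1 s1 => m1 h1 s1.
  have e21 : m1 21 = o by rewrite s1.
  have [||h2 s2] := @loadP o m1 23 a e21; [by []|lia|].
  move: (foldl _ _ (load 23 a)) h2 s2 => m2 h2 s2.
  rewrite /effect /= upd_eq upd_neq // h2 (s2 21) // (s2 24) // h1 e21 s1 ?hs ?inE; last by lia.
  by rewrite addnC.
Qed.

Lemma padP k m l : let m1 := foldl effect m (nseq k (Const 25 0)) in
  same [:: 25] m m1 /\ foldl effect m (pad (k + size l) l) = foldl effect m1 l.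
Proof.
split; last by rewrite /pad addnK foldl_cat.
by apply: same_block; rewrite ?all_nseq ?orbT.
Qed.

Lemma sim_effect o m0 s m base len i : 26 < o -> m0 21 = o ->
  sim_rel o m0 s m -> ~~ is_jump i ->
  sim_rel o m0 (effect s i) (foldl effect m (sim_block base len i)).
Proof.
move=> lo m21 [hs top fr] nj.
have sz : size (sim_core i ++ sim_tail) <= 12 by case: i nj.
have -> : sim_block base len i =
    pad (12 - size (sim_core i ++ sim_tail) + size (sim_core i ++ sim_tail))
      (sim_core i ++ sim_tail) by rewrite subnK //; case: i nj sz.
have [] := padP (12 - size (sim_core i ++ sim_tail)) m (sim_core i ++ sim_tail).
set m1 := foldl _ _ _ => sm1 ->.
have hs1 a : m1 (o + a) = s a by rewrite sm1 ?hs // inE; lia.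
have f21 : m1 21 = o by rewrite sm1 // fr //; lia.
have [] := sim_coreP lo f21 hs1 nj; rewrite foldl_cat.
set m2 := foldl effect m1 _ => e23 e24 sm2.
have e22 : m2 22 = m 22 by rewrite sm2 // sm1.
rewrite effect_upd //; set a := o + dest s i.
have E : foldl effect m2 sim_tail =
    upd (upd (upd m2 a (value s i)) 25 (a - m 22)) 22 (m 22 + (a - m 22)).
  rewrite /effect /= e23 e24 -/a.
  by rewrite (@upd_neq _ _ _ 23) ?(@upd_neq _ _ _ 22) ?upd_eq ?e23 ?e22 // /a; lia.
rewrite E; split=> [b|b|j lt_j].
- rewrite (@upd_neq _ 22) 1?(@upd_neq _ 25); try lia.
  rewrite /upd /a eqn_add2l; case: ifP => // _.
  by rewrite sm2 ?hs1 // !inE; lia.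
- rewrite upd_eq /a => lt; rewrite upd_neq; last by lia.
  by apply: top; lia.
- move=> nj'; have := nj'; rewrite !inE => nj2.
  rewrite !upd_neq /a; try lia.
  by rewrite sm2 ?sm1 ?fr // !inE; lia.
Qed.

Lemma sim_rel_same o m0 s m m' : 26 < o -> sim_rel o m0 s m ->
  same [:: 23; 24; 25] m m' -> sim_rel o m0 s m'.
Proof.
move=> lo [hs top fr] sm; split=> [a|a|j lt_j nj].
- by rewrite sm ?hs // !inE; lia.
- by rewrite sm //; apply: top.
- by rewrite sm ?fr //; apply: contra nj; rewrite !inE; lia.
Qed.

Lemma placed_flatten Q a (f : instr -> program) l k i :
  (forall i, size (f i) = 12) -> placed Q a (flatten [seq f i | i <- l]) ->
  onth l k = Some i -> placed Q (a + 12 * k) (f i).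
Proof.
move=> sz; elim: l a k => [|j l IH] a [|k] //= /placed_cat[pl1 pl2].
  by case=> <-; rewrite muln0 addn0.
by move=> e; rewrite mulnS addnA -{1}(sz j); apply: IH e.
Qed.

Lemma goes_sim_step Q P base o m0 k s m : 26 < o -> m0 21 = o ->
  placed Q base (simulate P base) -> sim_rel o m0 s m ->
  let pos k := base + 12 * minn k (size P) in
  goes Q (Config (pos k) m) 12 (fun y =>
    let x := step P (Config k s) in
    pc y = pos (pc x) /\ sim_rel o m0 (Defs.mem x) (Defs.mem y)).
Proof.
move=> lo m21 pl rel pos; rewrite /step [pc (Config _ _)]/=.
(* A halted machine is stationary, and no simulating step is made. *)
case E: (onth P k) => [i|]; last exact: goes0.
have lt_k : k < size P by rewrite -onthTE E.
have posk : pos k = base + 12 * k by rewrite /pos (minn_idPl (ltnW lt_k)).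
have posk1 : pos k.+1 = pos k + 12 by rewrite posk /pos (minn_idPl lt_k); lia.
have pli : placed Q (pos k) (sim_block base (size P) i).
  by rewrite posk; apply: placed_flatten pl E => j; apply: size_sim_block.
case: (boolP (is_jump i)) => ji; last first.
  have nj : all (fun i => ~~ is_jump i) (sim_block base (size P) i).
    by case: i ji {E pli}.
  have [t le_t [e1 e2]] := @hoare_block _ m (eq (foldl effect m (sim_block base (size P) i))) nj (erefl _) Q _ pli.
  exists t; first by move: le_t; rewrite size_sim_block.
  have -> : exec i (Config k s) = Config k.+1 (effect s i) by case: i ji {E pli nj le_t e1 e2}.
  by rewrite e1 -e2 /block size_sim_block posk1; split=> //; apply: sim_effect.
case: i ji E pli => // a l _ E /placed_cat[pl1 /placed_cons[eJ _]].
have m21' : m 21 = o by case: rel => _ _ fr; rewrite fr //; lia.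
have hs a' : m (o + a') = s a' by case: rel => ->.
(* [load] has three instructions, so [pad 11] puts eight in front. *)
have [sm1 e1] := padP 8 m (load 23 a); set m1 := foldl _ _ _ in sm1 e1.
have f21 : m1 21 = o by rewrite sm1.
have [||h2 sm2] := @loadP o m1 23 a f21; [by []|lia|].
rewrite -e1 in h2 sm2; set m2 := foldl _ _ _ in h2 sm2.
have {h2} h2 : m2 23 = s a by rewrite h2 sm1 ?hs // inE; lia.
have rel2 : sim_rel o m0 s m2.
  apply: sim_rel_same lo rel _; apply: same_trans (same_sub _ sm1) (same_sub _ sm2);
  by move=> j; rewrite !inE => ->; rewrite ?orbT.
apply: (@goes_bind _ _ 11 1 (fun y => y = Config (pos k + 11) m2)).
  have [t le_t] := @hoare_block (pad 11 (load 23 a)) m (eq m2) isT (erefl _) Q _ pl1.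
  case Ey: (iter _ _ _) => [k' m'] [/= ek em]; exists t => //.
  by rewrite Ey ek -em.
move=> y ->; apply: goes_jump eJ _; apply: goes0; rewrite h2 /=.
by case: ifP => _; split=> //; rewrite posk1 [RHS]addnS.
Qed.

Lemma goes_sim Q P base o m0 t x m : 26 < o -> m0 21 = o ->
  placed Q base (simulate P base) -> sim_rel o m0 (Defs.mem x) m ->
  let pos k := base + 12 * minn k (size P) in
  goes Q (Config (pos (pc x)) m) (t * 12) (fun y =>
    let x' := iter t (step P) x in
    pc y = pos (pc x') /\ sim_rel o m0 (Defs.mem x') (Defs.mem y)).
Proof.
move=> lo m21 pl rel pos; elim: t x m rel => [|t IH] [k s] m rel.
  exact: goes0.
rewrite mulSn iterSr; apply: goes_bind (goes_sim_step k lo m21 pl rel) _.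
case=> k' m' [/= -> rel']; exact: IH.
Qed.

Lemma hoareu_simulate P o m0 s r m : 26 < o -> m0 21 = o ->
  sim_rel o m0 (Defs.mem (init s)) m ->
  (exists t, outputs_within P t s r) ->
  hoareu (simulate P) m (fun m' => exists2 s', sim_rel o m0 s' m' &
    mkseq (fun i => s' i.+1) (s' 0) = r).
Proof.
move=> lo m21 rel [t [hh out]] Q a pl; exists (t * 12).
have [t' le_t] := goes_sim t lo m21 pl rel.
(* On halting the counter is at least [size P], which puts the simulation at the end of its code. *)
rewrite /= min0n muln0 addn0; move: hh out; case: (iter t _ _) => k s' /=.
rewrite /halted /output /= => /minn_idPr-> out [e rel'].
exists t' => //; split; last by exists s'.
rewrite e /simulate size_flatten /shape -map_comp.
rewrite (eq_map (g := fun=> 12)); last by move=> i /=; rewrite size_sim_block.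
by congr (a + _); elim: (P) => //= _ l <-; rewrite mulnS.
Qed.

(** * Clearing the simulated memory *)

Definition clear_init : program :=
  [:: Add 24 22 2; Sub 24 24 21; Const 25 0; Const 23 0; Add 23 23 21].
Definition clear_body : program := [:: Store 23 25; Add 23 23 2; Sub 24 24 2].
Definition clear_code : code :=
  seqc (block clear_init) (loop 24 (block clear_body)).

Lemma hoareu_clear o m0 s m : 26 < o -> m0 21 = o -> m0 2 = 1 -> o <= m 22 ->
  sim_rel o m0 s m ->
  hoareu clear_code m (fun m' => (forall j, o <= j -> m' j = 0) /\
    forall j, 0 < j < o -> j \notin sim_regs -> m' j = m0 j).
Proof.
move=> lo m21 m2 le_top [hs top fr].
have f21 : m 21 = o by rewrite fr //; lia.
have f2 : m 2 = 1 by rewrite fr //; lia.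
set T := m 22; pose I k m' := [/\ k <= T + 1 - o, m' 24 = k, m' 23 = T + 1 - k,
  m' 25 = 0 /\ m' 2 = 1 & (forall j, o <= j -> j < T + 1 - k \/ T < j -> m' j = 0) /\
  forall j, 0 < j < o -> j \notin sim_regs -> m' j = m0 j].
apply: (hoareu_seq (Q1 := eq (foldl effect m clear_init))).
  by apply: (@hoare_exu _ _ 5); apply: hoare_block.
move=> m1 <-.
have zero j : T < j -> o <= j -> m j = 0.
  by move=> lt_j le_j; rewrite -(subnKC le_j) hs; apply: top; lia.
have loopI : hoareu (loop 24 (block clear_body)) (foldl effect m clear_init) (I 0).
  apply: (@hoareu_loop 24 _ I _ (T + 1 - o)).
  - by move=> k m' [].
  - move=> k m' [le_k h24 h23 [h25 h2] [z fr']].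
    apply: (@hoare_exu _ _ 3); apply: (@hoare_block clear_body) => //.
    rewrite /effect /= h23 h25; set b := T + 1 - k.+1.
    have lowb j : j < 27 -> (j == b) = false by rewrite /b; lia.
    rewrite !(@upd_neq _ b) ?lowb // h23 -/b.
    rewrite !(@upd_neq _ 23) // !(@upd_neq _ b) ?lowb // h24 h2.
    split; rewrite ?upd_eq //; first by lia.
    + by rewrite subn1.
    + by rewrite (@upd_neq _ 24) // upd_eq /b; lia.
    + by rewrite !upd_neq ?lowb.
    split=> j hj.
      move=> lt_j; rewrite (@upd_neq _ 24) ?(@upd_neq _ 23); try lia.
      by rewrite /upd; case: eqP => // nj; apply: z => //; lia.
    move=> nj; have := nj; rewrite !inE => nj2.
    by rewrite !upd_neq ?fr' // /b; lia.
  - have so : same [:: 0; 23; 24; 25] m (upd (foldl effect m clear_init) 0 1).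
      by apply: same_upd => //; apply: same_block.
    split; rewrite ?upd_neq //; try by regs; rewrite ?f2 ?f21 -/T; lia.
    split=> j hj; first by move=> hj2; rewrite so ?zero // ?inE; lia.
    move=> nj; have := nj; rewrite !inE => nj2.
    by rewrite so ?fr // ?inE; lia.
move=> Q a pl; have [t [t' le_t [e [_ _ _ _ [z fr']]]]] := loopI Q a pl.
exists t; exists t' => //; split=> //; split=> // j hj; apply: z => //; lia.
Qed.

(** * The machine computing the infinite word *)

Definition word_init : program :=
  [:: Const 2 1; Const 3 27; Add 26 1 2; Add 21 3 26; Const 1 0].
(** This writes the one-item list with the current length of the word into the shifted memory;
    register 22 ends as the address of the item, the largest one written. *)
Definition sim_input : program := [:: Store 21 2; Add 22 21 2; Store 22 1].
Definition fetch_letters : program :=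
  [:: Add 23 21 2; Fetch 4 23; Add 23 23 2; Fetch 5 23].
Definition advance : program := [:: Add 1 1 2; Sub 26 26 2].

Definition word_step (P : program) : code :=
  seqc (block sim_input)
  (seqc (simulate P)
  (seqc (block fetch_letters)
  (seqc clear_code
  (seqc decide_code (block advance))))).

Definition word_code (P : program) : code :=
  seqc (block word_init)
  (seqc (loop 26 (word_step P)) (block return_code)).

Section Word.
Variables (P : program) (L : nat -> seq nat) (i : nat).
Hypothesis compL : forall k, exists t, outputs_within P t [:: k] (L k).
Hypothesis sizeL : forall k, size (L k) = 2.

Let o := 27 + i.+1.

(** Room for [i + 1] letters is reserved from address 27 up to [o]; the zeros from [o] on let the
    next simulation start in an initial memory. *)
Definition word_inv k (m : nat -> nat) : Prop :=
  let n := i.+1 - k in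
  [/\ k <= i.+1, m 26 = k, m 1 = n /\ m 2 = 1, m 3 = 27 /\ m 21 = o
    & [/\ stores 27 (pref L n) m, 0 < n -> m 20 = word L n.-1
        & forall j, o <= j -> m j = 0]].

Lemma hoareu_word_step k m :
  word_inv k.+1 m -> hoareu (word_step P) m (word_inv k).
Proof.
move=> [le_k m26 [m1 m2] [m3 m21] [st _ z]]; set n := i.+1 - k.+1 in m1 st.
have lo : 26 < o by rewrite /o; lia.
pose ma := foldl effect m sim_input.
have maE : ma = upd (upd (upd m o 1) 22 (o + 1)) (o + 1) n.
  rewrite /ma /effect /= m21 m2 upd_eq.
  by rewrite !(@upd_neq _ o) ?(@upd_neq _ 22 _ 1) ?(@upd_neq _ o) ?m21 ?m2 ?m1 //; lia.
apply: (hoareu_seq (Q1 := eq ma)).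
  by apply: (@hoare_exu _ _ 3); apply: (@hoare_block sim_input).
move=> _ <-.
have ma_lo j : j < o -> j != 22 -> ma j = m j.
  by move=> lt_j nj; rewrite maE !upd_neq //; lia.
have ma22 : ma 22 = o + 1 by rewrite maE upd_neq ?upd_eq //; lia.
have rel : sim_rel o ma (Defs.mem (init [:: n])) ma.
  split=> // a.
    rewrite maE; case: a => [|[|a]] /=.
    - by rewrite addn0 (@upd_neq _ (o + 1)) ?(@upd_neq _ 22) ?upd_eq //; lia.
    - by rewrite upd_eq.
    - by rewrite !upd_neq ?z ?nth_nil //; lia.
  by rewrite ma22; case: a => [|[|a]] /=; rewrite ?nth_nil //; lia.
have ma21 : ma 21 = o by rewrite ma_lo ?m21.
apply: (hoareu_seq (hoareu_simulate lo ma21 rel (compL n))) => mb [s [hs top fr] out].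
have s0 : s 0 = 2 by have := congr1 size out; rewrite size_mkseq sizeL.
have s1 : s 1 = nth 0 (L n) 0 by rewrite -out s0.
have s2 : s 2 = nth 0 (L n) 1 by rewrite -out s0.
have mb_lo j : j < o -> j \notin sim_regs -> mb j = m j.
  move=> lt_j nj; rewrite fr // ma_lo //; apply: contra nj => /eqP->.
  by rewrite inE eqxx.
(* The cell [o] holds the output length 2, so it cannot lie above the largest address written. *)
have topb : o <= mb 22.
  by rewrite leqNgt; apply/negP => lt; move: (top 0); rewrite addn0 s0 => /(_ lt).
pose mc := foldl effect mb fetch_letters.
apply: (hoareu_seq (Q1 := eq mc)).
  by apply: (@hoare_exu _ _ 4); apply: (@hoare_block fetch_letters).
move=> _ <-.
have smc : same [:: 4; 5; 23] mb mc by apply: same_block.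
have mb21 : mb 21 = o by rewrite mb_lo.
have mb2 : mb 2 = 1 by rewrite mb_lo.
have mc4 : mc 4 = nth 0 (L n) 0.
  rewrite /mc /effect /= ?(upd_eq, upd_neq _ _ (isT : 4 != 5), upd_neq _ _ (isT : 4 != 23)).
  by rewrite mb21 mb2 upd_neq ?hs ?s1 //; lia.
have mc5 : mc 5 = nth 0 (L n) 1.
  rewrite /mc /effect /= !upd_eq.
  rewrite !(upd_neq _ _ (isT : 23 != 4), upd_eq, upd_neq _ _ (isT : 2 != 4), upd_neq _ _ (isT : 2 != 23)).
  by rewrite mb21 mb2 -addnA !upd_neq ?hs ?s2 //; lia.
have relc : sim_rel o mc s mc.
  have hs' a : mc (o + a) = s a.
    by rewrite smc; [exact: hs | rewrite !inE; lia].
  have e22 : mc 22 = mb 22 by rewrite smc.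
  by split=> //; rewrite e22.
have mc21 : mc 21 = o by rewrite smc.
have mc2 : mc 2 = 1 by rewrite smc.
have mc22 : o <= mc 22 by rewrite smc.
apply: (hoareu_seq (hoareu_clear lo mc21 mc2 mc22 relc)) => md [zd dfr].
have md_lo j : 0 < j < o -> j \notin [:: 4; 5; 22; 23; 24; 25] -> md j = m j.
  move=> hj; rewrite !inE => nj; rewrite dfr ?smc ?mb_lo ?inE //; lia.
have szp := size_pref L n.
have std : stores 27 (pref L n) md.
  move=> a lt_a; rewrite szp in lt_a.
  by rewrite md_lo ?st ?szp // ?inE /o; lia.
have ltn : 27 + n < o by rewrite /o /n; lia.
apply: (hoareu_seq (Q1 := fun m' => [/\ m' 20 = word L n, m' (27 + n) = word L n
   & same (27 + n :: decide_regs) md m'])).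
  apply: (@hoare_exu _ _ (decide_time (size (pref L n)))).
  apply: hoare_leq (@hoare_decide_code 27 (pref L n) (nth 0 (L n) 0) (nth 0 (L n) 1) md _ _ _ _ _ _ _) _ => //.
  - by rewrite szp md_lo.
  - by rewrite md_lo.
  - by rewrite md_lo.
  - by rewrite dfr.
  - by rewrite dfr.
  - by rewrite szp.
move=> me [e20 en se].
have me_lo j : 0 < j < 27 -> j \notin decide_regs -> me j = md j.
  by move=> hj nj; rewrite se // in_cons negb_or nj andbT; lia.
apply: (@hoare_exu _ _ 2); apply: (@hoare_block advance) => //.
have En : i.+1 - k = n.+1 by rewrite /n; lia.
have f1 : me 1 = n by rewrite me_lo // md_lo.
have f2 : me 2 = 1 by rewrite me_lo // md_lo.
have f26 : me 26 = k.+1 by rewrite me_lo // md_lo.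
have sf : same [:: 1; 26] me (foldl effect me advance) by apply: same_block.
rewrite /word_inv En; split=> //.
- exact: ltnW.
- by regs; rewrite f2 f26 subn1.
- by split; [regs; rewrite f1 f2 addn1 | rewrite sf].
- by split; rewrite sf // me_lo // md_lo.
split.
- rewrite prefS; apply: stores_cons.
    move=> a lt_a; rewrite szp in lt_a; rewrite sf ?inE; last by lia.
    rewrite se; first by rewrite std ?szp.
    by rewrite !inE; lia.
  by rewrite szp sf ?en // !inE; lia.
- by move=> _; rewrite sf.
- move=> j le_j; rewrite sf ?inE ?se ?zd // ?inE; lia.
Qed.

Lemma hoareu_word_code :
  hoareu (word_code P) (Defs.mem (init [:: i]))
    (fun m => m 0 = 1 /\ m 1 = word L i).
Proof.
apply: (hoareu_seq (Q1 := eq (foldl effect (Defs.mem (init [:: i])) word_init))).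
  by apply: (@hoare_exu _ _ 5); apply: (@hoare_block word_init).
move=> _ <-; apply: (hoareu_seq (Q1 := word_inv 0)).
  apply: (@hoareu_loop 26 _ word_inv _ i.+1).
  - by move=> k m [].
  - exact: hoareu_word_step.
  have m1 : Defs.mem (init [:: i]) 1 = i by [].
  have z j : o <= j -> Defs.mem (init [:: i]) j = 0.
    by move=> le_j; rewrite /= nth_default //=; rewrite /o in le_j; lia.
  move: (Defs.mem _) m1 z => m m1 z.
  have sm : same [:: 1; 2; 3; 21; 26] m (foldl effect m word_init).
    exact: same_block.
  have e1 : foldl effect m word_init 1 = 0 by regs.
  have e2 : foldl effect m word_init 2 = 1 by regs.
  have e3 : foldl effect m word_init 3 = 27 by regs.
  have e21 : foldl effect m word_init 21 = 27 + (i + 1) by regs; rewrite m1.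
  have e26 : foldl effect m word_init 26 = i + 1 by regs; rewrite m1.
  rewrite addn1 in e21 e26.
  move: (foldl _ _ _) sm e1 e2 e3 e21 e26 => m' sm e1 e2 e3 e21 e26.
  have up j : j != 0 -> upd m' 0 1 j = m' j by apply: upd_neq.
  rewrite /word_inv subnn; split; [exact: leqnn | by rewrite up | | | split].
  - by rewrite !up.
  - by rewrite !up.
  - by move=> j; rewrite ltn0.
  - by move: (word L _) (upd _ _ _ _) => v f; rewrite ltnn.
  - move=> j le_j; rewrite up ?sm ?z // ?inE; rewrite /o in le_j; lia.
move=> m [_ _ _ _ [_ /(_ isT) e20 _]].
by apply: (@hoare_exu _ _ 3); apply: (@hoare_block return_code).
Qed.
End Word.

Lemma outputs_leq P t t' s r :
  t <= t' -> outputs_within P t s r -> outputs_within P t' s r.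
Proof.
move=> le_t; rewrite /outputs_within -(subnK le_t) iterD => -[h e].
by rewrite iter_step_halted.
Qed.

Lemma placed_self c : placed (c 0) 0 (c 0).
Proof. by []. Qed.

Lemma nth_letters (B : {fset nat}) : #|` B| = 2 ->
  letters B = [:: nth 0 (letters B) 0; nth 0 (letters B) 1].
Proof.
move=> sz; have := size_letters B; rewrite sz.
by case: (letters B) => [|a [|b []]].
Qed.

Theorem theorem3 :
  exists (P : program) (c k : nat),
  forall A : nat -> {fset nat},
    computable_alphabets A ->
    (forall i : nat, #|` A i| = 2) ->
    exists w : nat -> nat,
      computable_word w /\
      cube_free w /\
      (forall i : nat, w i \in A i) /\
      (forall n : nat,
         outputs_within P (c * n ^ k + c) (encode (mkseq w n) (A n)) [:: w n]).
Proof.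
(* The time bound proved for this machine is [60 n^2 + 584 n + 1481]. *)
exists (next_letter 0), 2000, 2 => A [P compA] sz.
pose L i := letters (A i).
have neq k : nth 0 (L k) 0 != nth 0 (L k) 1 by apply: letters_neq.
have sizeL k : size (L k) = 2 by rewrite size_letters.
exists (word L); split; [|split; [|split]].
- exists (word_code P 0) => i.
  have [T h] := @hoareu_word_code P L i compA sizeL _ 0 (@placed_self _).
  by exists T; apply: goes_outputs.
- exact: cube_free_word.
- by move=> i; apply: word_mem.
move=> n; apply: (@outputs_leq _ (42 + (7 + (n * 6 + 3)) + (4 + (decide_time n + 3)))).
  by rewrite /decide_time /total_time; nia.
have := @hoare_next_letter (pref L n) (nth 0 (L n) 0) (nth 0 (L n) 1) _ 0 (@placed_self _).
rewrite rev_pref size_pref -nth_letters // => h.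
by rewrite /encode size_mkseq; apply: goes_outputs.
Qed.
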